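(* Let $\rho:\mathbb{R}_{\ge0}^2\to[0,1]$ be defined by $\rho(z,c)=\min_{\psi\in\mathcal{I}_c^\infty}\alpha(\psi)+z\,\beta(\psi)$. Then $\rho$ is the unique solution, among functions $\mathbb{R}_{\ge0}^2\to[0,1]$, of the integral equation $$\frac{g(z)-\rho(z,c)}{c}=\max_{b\ge\max\{1,c\}}\frac{g(z)-\mathbb{E}_0\bigl[\rho\bigl(z\frac{p_1(X)}{p_0(X)},b-1\bigr)\bigr]}{b},\qquad z\ge0,\ c>0,$$ with boundary condition $\rho(z,0)=g(z)$ for all $z\ge0$.
   Context: $(\mathcal{X},\mathcal{F})$ is a measurable space, $\bm{X} = (X_1,X_2,\ldots)$ a random sequence in $\mathcal{X}$, $\bm{x}_t=(x_1,\ldots,x_t)$. Under hypothesis $\mathcal{H}_i$, $i\in\{0,1\}$, $\bm{X}$ is i.i.d. according to $P_i$. Standing assumptions: $P_1$ is absolutely continuous with respect to $P_0$, and $D_{\mathrm{KL}}(P_0\Vert P_1)$ is non-zero and finite; $p_0,p_1$ are the densities of $P_0,P_1$ with respect to a suitable background measure. $\mathbb{E}_0$ is expectation under $\mathcal{H}_0$, $X$ is a generic observation, and $g(z)=\min\{1,z\}$ for $z\ge0$. Candidate solutions are understood to be such that the expectations in the equation are defined. A stopping policy is a sequence $\psi=(\psi_0,\psi_1,\ldots)$ of (measurable) functions $\psi_t=\psi_t(\bm{x}_t)\in[0,1]$ ($\psi_0$ a constant), where $\psi_t(\bm{x}_t)$ is the probability of stopping at time $t$ given that the test has not stopped before and $\bm{x}_t$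 has been observed. $T$ is the resulting stopping time, with $\mathbb{P}[T=t\mid\bm{X}_t=\bm{x}_t]=\psi_t(\bm{x}_t)\prod_{n=0}^{t-1}(1-\psi_n(\bm{x}_n))$. $\mathcal{I}_c^\infty$ is the set of stopping policies $\psi$ such that, for every $\bm{x}\in\mathcal{X}^\infty$, the conditional expectation of $T$ given $\bm{X}=\bm{x}$ is at most $c$ (equivalently, $\mathbb{E}_{\mathbf{P},\psi}[T]\le c$ for every distribution $\mathbf{P}$ of $\bm{X}$ on $\mathcal{X}^\infty$). $\alpha(\psi)$ and $\beta(\psi)$ are the Type I and Type II error probabilities (the probability of deciding for $\mathcal{H}_1$ under $\mathcal{H}_0$, and for $\mathcal{H}_0$ under $\mathcal{H}_1$) of the test that uses stopping policy $\psi$ and, upon stopping at $T=t$, decides for $\mathcal{H}_1$ if $z\prod_{n=1}^t\frac{p_1(x_n)}{p_0(x_n)}>1$, for $\mathcal{H}_0$ if it is $<1$, and arbitrarily if it equals $1$. Thus $\alpha(\psi)+z\beta(\psi)=\mathbb{E}_{0,\psi}\bigl[g\bigl(z\prod_{t=1}^T\frac{p_1(X_t)}{p_0(X_t)}\bigr)\bigr]$. The minimum defining $\rho$ is attained. *)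

(* Defs.v *)
From HB Require Import structures.
From mathcomp Require Import all_boot all_order all_algebra.
From mathcomp Require Import all_classical all_reals all_analysis.
Import Order.TTheory GRing.Theory Num.Theory.
Import numFieldNormedType.Exports.

Set Implicit Arguments.
Unset Strict Implicit.
Unset Printing Implicit Defensive.

Local Open Scope classical_set_scope.
Local Open Scope ring_scope.

Section Definitions.
Context {R : realType} {d : measure_display} {X : measurableType d}.

Definition is_density (mu : {measure set X -> \bar R}) (P : probability X R)
    (p : X -> R) : Prop :=
  [/\ measurable_fun [set: X] p, forall x, 0 <= p x &
      forall A, measurable A -> P A = (\int[mu]_(x in A) (p x)%:E)%E].

(* The integrand is log (p0 / p1), equal to +oo where p1 vanishes; its value
   where p0 vanishes is irrelevant, since that set is P0-null. *)
Definition KL (P0 : probability X R) (p0 p1 : X -> R) : \bar R :=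
  (\int[P0]_x (if p1 x == 0%R then +oo else (ln (p0 x / p1 x))%:E))%E.

(* [xi n] is the observation at time n.+1. *)
Definition iid d' (Omega : measurableType d') (Pr : probability Omega R)
    (P : probability X R) (xi : nat -> Omega -> X) : Prop :=
  [/\ forall n, measurable_fun [set: Omega] (xi n),
      forall n A, measurable A -> Pr (xi n @^-1` A) = P A &
      forall n (A : nat -> set X), (forall i, measurable (A i)) ->
        Pr [set w | forall i, (i < n)%N -> A i (xi i w)]
        = (\prod_(i < n) Pr (xi i @^-1` A i))%E].

(* A [0, 1]-valued measurable function of the first t observations for each
   t; serves for stopping policies and for randomized decisions alike. *)
Definition rule := forall t : nat, t.-tuple X -> R.

Definition is_rule (psi : rule) : Prop :=
  forall t, measurable_fun [set: t.-tuple X] (psi t) /\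
            forall x, 0 <= psi t x <= 1.

Definition prefix (x : nat -> X) (t : nat) : t.-tuple X :=
  [tuple x i | i < t].

(* P[T = t | X = x] *)
Definition stop_prob (psi : rule) (x : nat -> X) (t : nat) : R :=
  psi t (prefix x t) * \prod_(n < t) (1 - psi n (prefix x n)).

(* E[T | X = x]. The second summand is the contribution of T = +oo, with the
   convention +oo * 0 = 0: without it a policy that never stops would have
   expected stopping time 0. *)
Definition mean_time (psi : rule) (x : nat -> X) : \bar R :=
  (\sum_(0 <= t <oo) (t%:R * stop_prob psi x t)%:E
   + +oo * (1 - \sum_(0 <= t <oo) (stop_prob psi x t)%:E))%E.

Definition budget_policies (c : R) : set rule :=
  [set psi | is_rule psi /\ forall x : nat -> X, (mean_time psi x <= c%:E)%E].

Definition lratio (p0 p1 : X -> R) t (x : t.-tuple X) : R :=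
  \prod_(i < t) (p1 (tnth x i) / p0 (tnth x i)).

(* Probability of deciding for H_1 upon stopping; [tie] is the arbitrary
   decision taken when the weighted likelihood ratio equals 1. *)
Definition decision (p0 p1 : X -> R) (tie : rule) (z : R) : rule :=
  fun t x => if 1 < z * lratio p0 p1 x then 1
             else if z * lratio p0 p1 x < 1 then 0 else tie t x.

Section Errors.
Context {d' : measure_display} {Omega : measurableType d'}.
Implicit Type xi : nat -> Omega -> X.

(* P[T < +oo and a decision taken with probability dec T (X_1, ..., X_T)] *)
Definition stop_and_decide (Pr : probability Omega R) xi (psi dec : rule) : R :=
  fine (\sum_(0 <= t <oo)
    'E_Pr[(fun w => stop_prob psi (xi^~ w) t * dec t (prefix (xi^~ w) t))%R])%E.

Definition type1_error (Pr0 : probability Omega R) xi (psi dec : rule) : R :=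
  stop_and_decide Pr0 xi psi dec.

Definition type2_error (Pr1 : probability Omega R) xi (psi dec : rule) : R :=
  stop_and_decide Pr1 xi psi (fun t x => 1 - dec t x).

Definition cost (Pr0 Pr1 : probability Omega R) xi (p0 p1 : X -> R)
    (tie : R -> rule -> rule) (z : R) (psi : rule) : R :=
  let dec := decision p0 p1 (tie z psi) z in
  type1_error Pr0 xi psi dec + z * type2_error Pr1 xi psi dec.

(* The minimum is attained, hence equal to the infimum. *)
Definition rho (Pr0 Pr1 : probability Omega R) xi (p0 p1 : X -> R)
    (tie : R -> rule -> rule) (z c : R) : R :=
  inf [set cost Pr0 Pr1 xi p0 p1 tie z psi | psi in budget_policies c].

End Errors.

Definition g (z : R) : R := Num.min 1 z.

Definition is_max (A : set R) (m : R) : Prop := A m /\ ubound A m.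

(* The functions R_{>=0}^2 -> [0, 1] are the functions on R^2 with values in
   [0, 1] on the nonnegative quadrant; their values elsewhere play no role. *)
Definition is_solution (P0 : probability X R) (p0 p1 : X -> R)
    (f : R -> R -> R) : Prop :=
  [/\ forall z c : R, 0 <= z -> 0 <= c -> 0 <= f z c <= 1,
      forall z c : R, 0 <= z -> 0 <= c ->
        P0.-integrable [set: X] (fun x => (f (z * (p1 x / p0 x)) c)%:E),
      forall z : R, 0 <= z -> f z 0 = g z &
      forall z c : R, 0 <= z -> 0 < c ->
        is_max
          [set (g z - fine ('E_P0[(fun x => f (z * (p1 x / p0 x)) (b - 1))%R])%E)
               / b
             | b in [set b | Num.max 1 c <= b]]
          ((g z - f z c) / c)].

End Definitions.

Arguments rule R {d} X.

(* Main.v *)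
Require Import Defs.
From mathcomp Require Import all_boot all_order all_algebra.
From mathcomp Require Import all_classical all_reals all_analysis.
From mathcomp Require Import measurable_realfun.
From mathcomp Require Import ring lra.
Import Order.TTheory GRing.Theory Num.Theory.
Import numFieldNormedType.Exports.
Local Open Scope classical_set_scope.
Local Open Scope ring_scope.

(* Conditioning on the first observation gives, for a policy that continues at
   time 0 with probability c / b, the cost
     (1 - c / b) g(z) + (c / b) E_0[cost of the tail policy at z p1 / p0],
   where the tail policy has budget b - 1; conversely, near-optimal tail
   policies can be selected measurably on a grid of values of z p1 / p0, since
   costs are 1-Lipschitz in z.  Hence (g(z) - rho(z, c)) / c is the supremum
   in the equation.  As that supremum is at most 1 and nonincreasing in c, rho
   is 1-Lipschitz in c, so the ratio is continuous in b and the supremum is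
   attained.
   For uniqueness, plug a maximizer b of one solution into the equation of the
   other: their difference satisfies delta(z, c) <= (c / b) E_0[delta(., b-1)],
   and delta <= min(1, c / n) then improves to delta <= c / (n + 1), because
   min(1, (b - 1) / n) <= b / (n + 1). *)

Set Implicit Arguments.
Unset Strict Implicit.
Unset Printing Implicit Defensive.

(* [seq.prefix] shadows the definition of Defs. *)
Local Notation prefix := Defs.prefix.
Local Notation g := Defs.g.

(** * Laws of finite prefixes *)

Section TupleMeasures.
Context {R : realType} {d : measure_display} {X : measurableType d}.

(** Sides are indexed by [nat], as in [iid], so that dropping the first side is the shift
    [fun i => A i.+1]. *)
Definition box n (A : nat -> set X) : set (n.-tuple X) :=
  [set y | forall i : 'I_n, A i (tnth y i)].

Lemma measurable_box n A : (forall i, measurable (A i)) ->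
  measurable (@box n A).
Proof.
move=> mA; rewrite (_ : @box n A = \bigcap_(i in [set: 'I_n])
    ((fun y : n.-tuple X => tnth y i) @^-1` A i)); last first.
  by apply/seteqP; split => y /= h; [move=> i _; exact: h|move=> i; exact: (h i)].
apply: fin_bigcap_measurable => // i _.
by rewrite -[X in measurable X]setTI; exact: measurable_tnth.
Qed.

Definition boxes n : set (set (n.-tuple X)) :=
  [set B | exists2 A, (forall i, measurable (A i)) & B = box A].

(** The product sigma-algebra is generated by preimages under single coordinates, and each of these
    is a box whose other sides are [setT]. *)
Lemma boxesE n : (measurable : set (set (n.-tuple X))) = <<s @boxes n >>.
Proof.
apply/seteqP; split.
  apply: smallest_sub; first exact: smallest_sigma_algebra.
  move=> B; rewrite -bigcup_seq/= => -[i _ [C mC <-]].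
  apply: sub_sigma_algebra.
  exists (fun j => if j == i :> nat then C else setT).
    by move=> j; case: ifP.
  rewrite setTI; apply/seteqP; split => y /=.
    by move=> Cy j; case: ifP => // /eqP/val_inj ->.
  by move=> /(_ i); rewrite eqxx.
apply: smallest_sub; first exact: sigma_algebra_measurable.
by move=> _ [A mA ->]; exact: measurable_box.
Qed.

(** Boxes are closed under intersection, side by side, and include the whole space, so they
    determine a finite measure. *)
Lemma tuple_measure_unique n (m1 m2 : {measure set (n.-tuple X) -> \bar R}) :
  (forall A, (forall i, measurable (A i)) -> m1 (box A) = m2 (box A)) ->
  (m1 setT < +oo)%E -> forall B, measurable B -> m1 B = m2 B.
Proof.
move=> m12 m1fin B mB.
apply: (measure_unique (@boxes n) (fun=> setT)) => //.
- exact: boxesE.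
- move=> _ _ [A mA ->] [A' mA' ->].
  exists (fun i => A i `&` A' i); first by move=> i; exact: measurableI.
  apply/seteqP; split => y /=; first by case=> h h' i.
  by move=> h; split=> i; have [] := h i.
- move=> _; exists (fun=> setT) => //; exact/seteqP.
- by apply/seteqP; split => // y _; exists 0%N.
- by move=> _ [A mA ->]; exact: m12.
Qed.

End TupleMeasures.

Section Iid.
Context {R : realType} {d : measure_display} {X : measurableType d}.
Context {d' : measure_display} {Omega : measurableType d'}.
Variables (Pr : probability Omega R) (P : probability X R).
Variable xi : nat -> Omega -> X.
Hypothesis hxi : iid Pr P xi.

Lemma measurable_prefix n :
  measurable_fun [set: Omega] (fun w => prefix (xi^~ w) n).
Proof.
apply/measurable_fun_tnthP => i; have [+ _ _] := hxi => /(_ i).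
by apply: eq_measurable_fun => w _ /=; rewrite tnth_mktuple.
Qed.

Lemma measurable_cons_prefix n : measurable_fun [set: X * Omega]
  (fun q => [tuple of q.1 :: prefix (xi^~ q.2) n]).
Proof.
apply: measurable_cons; first exact: measurable_fst.
exact: (measurableT_comp (@measurable_prefix n) measurable_snd).
Qed.

Lemma prefix_box n (A : nat -> set X) : (forall i, measurable (A i)) ->
  Pr ((fun w => prefix (xi^~ w) n) @^-1` box A) = (\prod_(i < n) P (A i))%E.
Proof.
move=> mA; have [mxi lawxi indep] := hxi.
have -> : (\prod_(i < n) P (A i) = \prod_(i < n) Pr (xi i @^-1` A i))%E.
  by apply: eq_bigr => i _; rewrite lawxi.
rewrite -indep//.
congr (Pr _); apply/seteqP; split => w /= h i.
  by move=> ltin; have := h (Ordinal ltin); rewrite tnth_mktuple.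
by rewrite tnth_mktuple; exact: h.
Qed.

(** On boxes, the law of the first n+1 observations and the image of [P \x Pr] under consing both
    give the product of the [P (A i)]; Tonelli then splits off the first observation. The remainder
    is a prefix of [xi] itself, not of a shifted sequence, so the identity can be iterated. *)
Lemma integral_prefixS n (h : n.+1.-tuple X -> \bar R) :
  measurable_fun [set: n.+1.-tuple X] h -> (forall y, 0 <= h y)%E ->
  (\int[Pr]_w h (prefix (xi^~ w) n.+1) =
   \int[P]_x \int[Pr]_w h [tuple of x :: prefix (xi^~ w) n])%E.
Proof.
move=> mh h0.
pose F : {mfun Omega >-> n.+1.-tuple X} := mfun_Sub (mem_set (@measurable_prefix n.+1)).
pose G : {mfun (X * Omega)%type >-> n.+1.-tuple X} :=
  mfun_Sub (mem_set (@measurable_cons_prefix n)).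
transitivity (\int[distribution Pr F]_y h y)%E.
  by rewrite ge0_integral_pushforward.
transitivity (\int[distribution (P \x Pr)%E G]_y h y)%E; last first.
  rewrite ge0_integral_pushforward// preimage_setT fubini_tonelli1//.
  - exact: (measurableT_comp mh (@measurable_cons_prefix n)).
  - by move=> q; exact: h0.
apply: eq_measure_integral => B mB _.
apply: tuple_measure_unique mB; last first.
  exact: (le_lt_trans (probability_le1 (distribution Pr F) measurableT) (ltry 1)).
move=> A mA.
have mA' i : measurable (A i.+1) by exact: mA.
transitivity (\prod_(i < n.+1) P (A i))%E; first exact: prefix_box.
rewrite big_ord_recl.
have -> : (\prod_(i < n) P (A (bump 0 i)) = \prod_(i < n) P (A i.+1))%E by [].
rewrite -(@prefix_box n (fun i => A i.+1))//.
rewrite -(@product_measure1E _ _ _ _ _ P Pr)//; last first.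
  rewrite -[X in measurable X]setTI; apply: measurable_prefix => //.
  exact: measurable_box.
congr ((P \x Pr)%E _); apply/seteqP; split => -[x w] /=.
  move=> [Ax h1] i; case: (unliftP ord0 i) => [j ->|->] //.
  by rewrite tnthS; exact: h1.
move=> h1; split; first by have := h1 ord0.
by move=> j; have := h1 (lift ord0 j); rewrite tnthS.
Qed.

End Iid.

(** * Likelihood ratios *)

Section Density.
Context {R : realType} {d : measure_display} {X : measurableType d}.

Import HBNNSimple.

Lemma integral_density_nnsfun (mu nu : {measure set X -> \bar R}) (q : X -> R)
    (h : {nnsfun X >-> R}) :
  measurable_fun [set: X] q -> (forall x, 0 <= q x) ->
  (forall A, measurable A -> nu A = \int[mu]_(x in A) (q x)%:E)%E ->
  (\int[nu]_x (h x)%:E = \int[mu]_x ((h x)%:E * (q x)%:E))%E.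
Proof.
move=> mq q0 nuE.
have mi r : measurable_fun [set: X] (fun x => (r * \1_(h @^-1` [set r]) x)%:E).
  by apply/measurable_EFinP; exact: measurable_funM.
have mqE : measurable_fun [set: X] (EFin \o q) by exact/measurable_EFinP.
under eq_integral do rewrite fimfunE -fsumEFin//.
rewrite ge0_integral_fsum//; last by move=> r x _; exact: nnfun_muleindic_ge0.
under [RHS]eq_integral => x _ do
  (rewrite fimfunE -fsumEFin// ge0_mule_fsuml;
     last by move=> r; exact: nnfun_muleindic_ge0).
rewrite ge0_integral_fsum//; last 2 first.
- by move=> r; exact: emeasurable_funM.
- by move=> r x _; rewrite mule_ge0 ?lee_fin//; exact: nnfun_muleindic_ge0.
apply: eq_fsbigr => r; rewrite inE => -[t _ <-].
rewrite integralZl_indic_nnsfun// integral_indic// setIT nuE//.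
rewrite [in RHS](eq_integral (fun x => (h t)%:E *
    ((EFin \o q) \_ (h @^-1` [set h t])) x)%E); last first.
  by move=> x _; rewrite epatch_indic/= EFinM -muleA (muleC (\1_ _ _)%:E).
rewrite ge0_integralZl//.
- by rewrite -integral_mkcond.
- apply/(measurable_restrictT _ _).1 => //; exact: measurable_funTS.
- by move=> x _; rewrite patchE; case: ifP => // _; rewrite lee_fin.
- by rewrite lee_fin.
Qed.

(** Monotone convergence on both sides, along simple functions increasing to [f]. *)
Lemma ge0_integral_density (mu nu : {measure set X -> \bar R}) (q : X -> R)
    (f : X -> \bar R) :
  measurable_fun [set: X] q -> (forall x, 0 <= q x) ->
  (forall A, measurable A -> nu A = \int[mu]_(x in A) (q x)%:E)%E ->
  measurable_fun [set: X] f -> (forall x, 0 <= f x)%E ->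
  (\int[nu]_x f x = \int[mu]_x (f x * (q x)%:E))%E.
Proof.
move=> mq q0 nuE mf f0.
pose h := nnsfun_approx measurableT mf.
have mqE : measurable_fun [set: X] (EFin \o q) by exact/measurable_EFinP.
have hf x : (EFin \o h^~ x) n @[n --> \oo] --> f x.
  exact: (@cvg_nnsfun_approx _ _ _ _ measurableT _ mf).
have h_nd x a b : (a <= b)%N -> h a x <= h b x.
  by move=> ab; exact/lefP/nd_nnsfun_approx.
have cvl : (\int[nu]_x (h n x)%:E @[n --> \oo] --> \int[nu]_x f x)%E.
  have -> : f = (fun x => limn (EFin \o h^~ x)).
    by apply/funext => x; apply/esym/cvg_lim => //; exact: hf.
  apply: cvg_monotone_convergence => //.
  - by move=> n; exact/measurable_EFinP.
  - by move=> n x _; rewrite lee_fin.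
  - by move=> x _ a b ab; rewrite lee_fin h_nd.
have cvr : (\int[mu]_x ((h n x)%:E * (q x)%:E) @[n --> \oo] -->
            \int[mu]_x (f x * (q x)%:E))%E.
  have -> : (fun x => f x * (q x)%:E)%E =
            (fun x => limn (fun n => (h n x)%:E * (q x)%:E)%E).
    apply/funext => x; apply/esym/cvg_lim => //.
    by apply: cvgeZr => //; exact: hf.
  apply: cvg_monotone_convergence => //.
  - by move=> n; apply: emeasurable_funM => //; exact/measurable_EFinP.
  - by move=> n x _; rewrite mule_ge0// lee_fin.
  - by move=> x _ a b ab; rewrite lee_wpmul2r ?lee_fin// h_nd.
have hnE : (fun n => \int[nu]_x (h n x)%:E)%E =
           (fun n => \int[mu]_x ((h n x)%:E * (q x)%:E))%E.
  by apply/funext => n; exact: integral_density_nnsfun.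
by rewrite hnE in cvl; exact: (cvg_unique _ cvl cvr).
Qed.

Lemma measurable_funV (f : X -> R) :
  measurable_fun [set: X] f -> measurable_fun [set: X] (fun x => (f x)^-1).
Proof.
move=> mf; suff mV : measurable_fun [set: R] (@GRing.inv R).
  exact: measurableT_comp mV mf.
have m0 : measurable (~` [set (0 : R)]) by exact: measurableC.
(* Inversion is continuous only away from 0, so the point 0 is treated separately. *)
rewrite -(setUv [set (0 : R)]); apply/measurable_funU => //; split.
  exact: measurable_fun_set1.
apply: open_continuous_measurable_fun.
  by apply: closed_openC; exact: closed_eq.
move=> x; rewrite inE/= => /eqP x0; exact: inv_continuous.
Qed.

Variables (mu : {measure set X -> \bar R}) (P0 P1 : probability X R).
Variables p0 p1 : X -> R.
Hypotheses (hp0 : is_density mu P0 p0) (hp1 : is_density mu P1 p1).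

Lemma measurable_ratio : measurable_fun [set: X] (fun x => p1 x / p0 x).
Proof.
have [mp0 _ _] := hp0; have [mp1 _ _] := hp1.
by apply: measurable_funM => //; exact: measurable_funV.
Qed.

Lemma ratio_ge0 x : 0 <= p1 x / p0 x.
Proof. by have [_ ? _] := hp0; have [_ ? _] := hp1; exact: divr_ge0. Qed.

(** The quotient is 0 where [p0] vanishes, so the integral misses the mass of [P1] there. That set
    is P0-null, hence P1-null by absolute continuity; off it, [p0] cancels. *)
Lemma ratio_density (hdom : P1 `<< P0) A : measurable A ->
  P1 A = (\int[P0]_(x in A) (p1 x / p0 x)%:E)%E.
Proof.
have [mp0 p0_ge0 P0E] := hp0; have [mp1 p1_ge0 P1E] := hp1 => mA.
have mr : measurable_fun [set: X] (EFin \o (fun x => p1 x / p0 x)).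
  by apply/measurable_EFinP; exact: measurable_ratio.
have mp1E : measurable_fun [set: X] (EFin \o p1) by exact/measurable_EFinP.
pose Z : set X := [set x | p0 x = 0].
have mZ : measurable Z.
  by rewrite -[Z]setTI; exact: (mp0 measurableT [set 0] (measurable_set1 0)).
have P1Z B : measurable B -> B `<=` Z -> P1 B = 0%E.
  move=> mB BZ.
  have P0B : P0 B = 0%E.
    by rewrite P0E//; apply: integral0_eq => x /BZ/= ->.
  by have /null_content_dominatesP := hdom; apply.
rewrite integral_mkcond (ge0_integral_density mp0 p0_ge0 P0E); last 2 first.
- apply/(measurable_restrictT _ _).1 => //; exact: measurable_funTS.
- by move=> x; rewrite patchE; case: ifP => // _; rewrite lee_fin ratio_ge0.
have -> : P1 A = P1 (A `\` Z).
  rewrite (measureDI _ mA mZ) [X in (_ + X)%E]P1Z ?adde0//.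
  exact: measurableI.
rewrite P1E; last exact: measurableD.
rewrite integral_mkcond; apply: eq_integral => x _.
rewrite !patchE in_setD; case: (x \in A) => /=; last by rewrite mul0e.
have [p0x|p0x] := eqVneq (p0 x) 0.
  by rewrite p0x mule0 mem_set.
rewrite -EFinM divfK// ifT//; apply/negP; rewrite inE => /eqP.
exact/negP.
Qed.

End Density.

(** * Stopping policies *)

Section Policies.
Context {R : realType} {d : measure_display} {X : measurableType d}.
Implicit Types (psi : rule R X) (x : nat -> X).

Definition scons (a : X) x (n : nat) : X := if n is n'.+1 then x n' else a.

Definition tail_rule psi (a : X) : rule R X :=
  fun t y => psi t.+1 [tuple of a :: y].

Lemma prefix0 x : prefix x 0 = [tuple].
Proof. exact: tuple0. Qed.

Lemma prefix_scons a x n : prefix (scons a x) n.+1 = [tuple of a :: prefix x n].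
Proof.
apply: eq_from_tnth => i; rewrite tnth_mktuple.
by case: (unliftP ord0 i) => [j ->|->] //; rewrite tnthS tnth_mktuple.
Qed.

Lemma eq_prefix x x' n : (forall i, (i < n)%N -> x i = x' i) ->
  prefix x n = prefix x' n.
Proof.
by move=> xx'; apply: eq_from_tnth => i; rewrite !tnth_mktuple xx'.
Qed.

(** This is P[T >= n | X = x]. *)
Definition survival psi x n : R := \prod_(i < n) (1 - psi i (prefix x i)).

Lemma survivalS psi x n :
  survival psi x n.+1 = survival psi x n * (1 - psi n (prefix x n)).
Proof. by rewrite /survival big_ord_recr. Qed.

Lemma survival0 psi x : survival psi x 0 = 1.
Proof. by rewrite /survival big_ord0. Qed.

Lemma survival_scons psi a x n :
  survival psi (scons a x) n.+1 =
  (1 - psi 0%N [tuple]) * survival (tail_rule psi a) x n.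
Proof.
rewrite /survival big_ord_recl prefix0; congr (_ * _).
by apply: eq_bigr => i _; rewrite prefix_scons.
Qed.

(** In this form the sums of stopping probabilities telescope. *)
Lemma stop_probE psi x t :
  stop_prob psi x t = survival psi x t - survival psi x t.+1.
Proof. by rewrite survivalS /stop_prob -/(survival _ _ _); ring. Qed.

Lemma stop_prob0 psi x : stop_prob psi x 0 = psi 0%N [tuple].
Proof. by rewrite stop_probE survivalS survival0 prefix0; ring. Qed.

Lemma stop_prob_scons psi a x t :
  stop_prob psi (scons a x) t.+1 =
  (1 - psi 0%N [tuple]) * stop_prob (tail_rule psi a) x t.
Proof. by rewrite !stop_probE !survival_scons; ring. Qed.

Lemma eq_stop_prob psi x x' t : (forall i, (i < t)%N -> x i = x' i) ->
  stop_prob psi x t = stop_prob psi x' t.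
Proof.
move=> xx'; rewrite /stop_prob (eq_prefix xx'); congr (_ * _).
apply: eq_bigr => i _; congr (1 - psi _ _); apply: eq_prefix => j ji.
by apply: xx'; exact: ltn_trans ji _.
Qed.

Section Rule.
Variable psi : rule R X.
Arguments psi : clear implicits.
Hypothesis rpsi : is_rule psi.

Lemma rule_ge0 t y : 0 <= psi t y.
Proof. by have [_ /(_ y)/andP[]] := rpsi t. Qed.

Lemma rule_le1 t y : psi t y <= 1.
Proof. by have [_ /(_ y)/andP[]] := rpsi t. Qed.

Lemma survival_ge0 x n : 0 <= survival psi x n.
Proof. by apply: prodr_ge0 => i _; rewrite subr_ge0 rule_le1. Qed.

Lemma stop_prob_ge0 x t : 0 <= stop_prob psi x t.
Proof. by apply: mulr_ge0; [exact: rule_ge0|exact: survival_ge0]. Qed.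

Lemma survival_le x m n : (m <= n)%N -> survival psi x n <= survival psi x m.
Proof.
move=> /subnK <-; elim: (n - m)%N => [//|k ih]; rewrite addSn.
by apply: le_trans ih; rewrite -subr_ge0 -stop_probE stop_prob_ge0.
Qed.

Lemma sum_stop_prob x n :
  \sum_(0 <= t < n) stop_prob psi x t = 1 - survival psi x n.
Proof.
elim: n => [|n ih]; first by rewrite big_geq// survival0 subrr.
by rewrite big_nat_recr//= ih stop_probE; ring.
Qed.

Lemma nneseries_stop_prob_le1 x :
  (\sum_(0 <= t <oo) (stop_prob psi x t)%:E <= 1)%E.
Proof.
apply: lime_le.
  by apply: is_cvg_nneseries => n _ _; rewrite lee_fin stop_prob_ge0.
apply: nearW => n; rewrite sumEFin lee_fin sum_stop_prob.
by rewrite gerBl survival_ge0.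
Qed.

(** Summation by parts; the boundary term accounts for the paths still running after time n. *)
Lemma sum_survivalE x n :
  \sum_(0 <= t < n.+1) t%:R * stop_prob psi x t =
  \sum_(0 <= t < n) survival psi x t.+1 - n%:R * survival psi x n.+1.
Proof.
elim: n => [|n ih]; first by rewrite big_nat1 big_geq// !mul0r subr0.
rewrite big_nat_recr//= ih [in RHS]big_nat_recr//= stop_probE -natr1; ring.
Qed.

Lemma le_sum_stop_prob x n :
  ((1 - survival psi x n)%:E <= \sum_(0 <= t <oo) (stop_prob psi x t)%:E)%E.
Proof.
rewrite -sum_stop_prob -sumEFin; apply: nneseries_lim_ge => t _ _.
by rewrite lee_fin stop_prob_ge0.
Qed.

(* [survival psi x t.+1] is P[T > t | X = x], so the sum tends to E[T | X = x]. *)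
Lemma mean_time_le_survival c x n : (mean_time psi x <= c%:E)%E ->
  \sum_(0 <= t < n) survival psi x t.+1 <= c.
Proof.
rewrite /mean_time; set A := (X in (X + _)%E); set B := (X in (1 - X)%E) => ABc.
have tS0 t : (0 <= (t%:R * stop_prob psi x t)%:E)%E.
  by rewrite lee_fin mulr_ge0// stop_prob_ge0.
have A0 : (0 <= A)%E by apply: nneseries_ge0 => t _ _; exact: tS0.
(* If the stopping probabilities summed to less than 1, the [+oo] summand would make [mean_time]
   infinite. *)
have B1 : B = 1%E.
  apply/eqP; rewrite eq_le nneseries_stop_prob_le1/= leNgt; apply/negP => B1.
  have : (0 < 1 - B)%E by rewrite sube_gt0.
  move=> /gt0_mulye B1y; move: ABc.
  by rewrite B1y addey ?leye_eq// -ltNye (lt_le_trans _ A0).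
move: ABc; rewrite B1 subee// mule0 adde0 => Ac.
(* Summation by parts, with the boundary term spread evenly over the m summands. *)
have sumc m : \sum_(0 <= t < m) (survival psi x t.+1 - survival psi x m.+1) <= c.
  rewrite sumrB big_const_nat iter_addr_0 subn0 -mulr_natl -sum_survivalE.
  rewrite -lee_fin -sumEFin; apply: le_trans Ac.
  by apply: nneseries_lim_ge => t _ _; exact: tS0.
apply/ler_addgt0Pr => e e0.
(* Each of the n summands loses [survival psi x m.+1]; keeping this below e / (n + 1) makes the
   total loss at most e, also when n = 0. *)
have enpos : 0 < e / n.+1%:R by rewrite divr_gt0.
have [M VM] : exists M, survival psi x M < e / n.+1%:R.
  apply: contrapT => /forallNP noM.
  have : (B <= (1 - e / n.+1%:R)%:E)%E.
    apply: lime_le.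
      by apply: is_cvg_nneseries => t _ _; rewrite lee_fin stop_prob_ge0.
    apply: nearW => m; rewrite sumEFin lee_fin sum_stop_prob lerB//.
    by rewrite leNgt; exact/negP.
  by rewrite B1 lee_fin; move: enpos; set u := e / _; lra.
pose m := maxn n M.
have Vm : survival psi x m.+1 <= e / n.+1%:R.
  by apply: le_trans (ltW VM); apply: survival_le; rewrite leqW// leq_maxr.
have : \sum_(0 <= t < n) (survival psi x t.+1 - survival psi x m.+1) <= c.
  apply: le_trans (sumc m).
  rewrite [leRHS](big_cat_nat (n := n))//= ?leq_maxl// lerDl.
  rewrite big_nat_cond sumr_ge0// => t; rewrite andbT => /andP[_ tm].
  by rewrite subr_ge0 survival_le// ltnW.
rewrite sumrB big_const_nat iter_addr_0 subn0 -mulr_natl lerBlDr.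
move=> /le_trans; apply; rewrite lerD2l.
apply: le_trans (ler_wpM2l (ler0n _ n) Vm) _.
rewrite mulrCA ger_pMr// ler_pdivrMr// mul1r ler_nat//.
Qed.

(** The bound on the sums forces [survival] to tend to 0, so the [+oo] summand vanishes; summation
    by parts then bounds the partial sums of the mean. *)
Lemma survival_le_mean_time c x :
  (forall n, \sum_(0 <= t < n) survival psi x t.+1 <= c) ->
  (mean_time psi x <= c%:E)%E.
Proof.
move=> sumc; rewrite /mean_time; set B := (X in (1 - X)%E).
have c0 : 0 <= c by have := sumc 0%N; rewrite big_geq.
(* Markov's inequality for T, from the monotonicity of [survival]. *)
have Vc n : n%:R * survival psi x n <= c.
  apply: le_trans (sumc n).
  have -> : n%:R * survival psi x n = \sum_(0 <= t < n) survival psi x n.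
    by rewrite big_const_nat iter_addr_0 subn0 mulr_natl.
  rewrite big_nat_cond [leRHS]big_nat_cond; apply: ler_sum => t.
  by rewrite andbT => /andP[_ tn]; exact: survival_le.
have B1 : B = 1%E.
  apply/eqP; rewrite eq_le nneseries_stop_prob_le1/=.
  apply/lee_addgt0Pr => e e0.
  pose n := (Num.truncn (c / e)).+1.
  have Ve : survival psi x n <= e.
    rewrite -(@ler_pM2l _ n%:R)//; apply: le_trans (Vc n) _.
    by rewrite -ler_pdivrMr// ltW// truncnS_gt.
  apply: le_trans (leeD2r e%:E (le_sum_stop_prob x n)).
  by rewrite lee_fin; lra.
rewrite B1 subee// mule0 adde0; apply: lime_le.
  by apply: is_cvg_nneseries => t _ _; rewrite lee_fin mulr_ge0// stop_prob_ge0.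
apply: nearW => -[|n]; rewrite sumEFin lee_fin; first by rewrite big_geq.
rewrite sum_survivalE; apply: le_trans (sumc n).
by rewrite gerBl mulr_ge0// survival_ge0.
Qed.

End Rule.
End Policies.

(** * The function g: bounds, monotonicity and Lipschitz constant 1 *)

Section TruncatedIdentity.
Context {R : realType}.
Implicit Types z : R.

Lemma g_ge0 z : 0 <= z -> 0 <= g z.
Proof. by move=> z0; rewrite /g le_min ler01. Qed.

Lemma g_le1 z : g z <= 1.
Proof. by rewrite /g ge_min lexx. Qed.

Lemma g_le z : g z <= z.
Proof. by rewrite /g ge_min lexx orbT. Qed.

Lemma g_homo : {homo (@g R) : y z / y <= z}.
Proof. by move=> y z yz; rewrite /g le_min !ge_min lexx yz/= orbT. Qed.

Lemma g_lipschitz y z : y <= z -> g z <= g y + (z - y).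
Proof.
move=> yz; rewrite {2}/g minElt; have := g_le1 z; have := g_le z.
by case: ltP => _; lra.
Qed.

Lemma measurable_g : measurable_fun [set: R] (@g R).
Proof. exact: measurable_minr. Qed.

End TruncatedIdentity.

(** * Measurability of policies, and gluing countably many of them *)

Section MeasurableRules.
Context {R : realType} {d : measure_display} {X : measurableType d}.
Implicit Types psi : rule R X.

(** The stopping probability at time t as a function of t observations only, so that it can be
    integrated against the law of a prefix; the padding by [point] is never read. *)
Definition stop_tuple psi t (y : t.-tuple X) : R := stop_prob psi (nth point y) t.

Lemma stop_tupleE psi x t : stop_prob psi x t = stop_tuple psi (prefix x t).
Proof.
apply: eq_stop_prob => i it; rewrite /prefix.
by rewrite (_ : i = Ordinal it :> nat)// -tnth_nth tnth_mktuple.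
Qed.

Lemma stop_tuple_cons psi a x t :
  stop_tuple psi [tuple of a :: prefix x t] = stop_prob psi (scons a x) t.+1.
Proof. by rewrite stop_tupleE prefix_scons. Qed.

Lemma measurable_take_tuple t n : (n <= t)%N ->
  measurable_fun [set: t.-tuple X] (fun y : t.-tuple X => prefix (nth point y) n).
Proof.
move=> nt; apply/measurable_fun_tnthP => i.
have it : (i < t)%N by exact: leq_trans nt.
apply: eq_measurable_fun (measurable_tnth (Ordinal it)) => y _ /=.
by rewrite tnth_mktuple (tnth_nth point).
Qed.

Lemma measurable_stop_tuple psi t : is_rule psi ->
  measurable_fun [set: t.-tuple X] (@stop_tuple psi t).
Proof.
move=> rpsi; apply: measurable_funM.
  have [mpsi _] := rpsi t; exact: (measurableT_comp mpsi (measurable_take_tuple _)).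
apply: measurable_prod => n _; apply: measurable_funB => //.
have [mpsi _] := rpsi n; apply: (measurableT_comp mpsi (measurable_take_tuple _)).
exact: ltnW.
Qed.

Lemma is_rule_tail psi a : is_rule psi -> is_rule (tail_rule psi a).
Proof.
move=> rpsi t; have [mpsi psi01] := rpsi t.+1; split; last by move=> x; exact: psi01.
by apply: (measurableT_comp mpsi); exact: measurable_cons.
Qed.

(* Its tails are those of [psi] and it never stops at time 0, so its stopping
   probabilities on [a :: y] are those of [tail_rule psi a] on [y]; unlike the
   latter they are visibly jointly measurable in [a] and [y]. *)
Definition never_stop_at0 psi : rule R X :=
  fun t => if t is t'.+1 then psi t'.+1 else fun=> 0.

Lemma is_rule_never psi : is_rule psi -> is_rule (never_stop_at0 psi).
Proof. by move=> rpsi [|t]; [split => //= x; rewrite lexx ler01|exact: rpsi]. Qed.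

(** Stop at time 0 with probability [s], otherwise follow the policy selected by the first
    observation. Selecting through a countable index keeps the result measurable. *)
Definition splice (s : R) (Psi : nat -> rule R X) (k : X -> nat) : rule R X :=
  fun t => if t is t'.+1 then
             fun y : t'.+1.-tuple X => Psi (k (thead y)) t' [tuple of behead y]
           else fun=> s.

Lemma tail_splice s Psi k a : tail_rule (splice s Psi k) a = Psi (k a).
Proof.
apply: functional_extensionality_dep => t; apply/funext => y.
rewrite /tail_rule /splice theadE; congr (Psi _ _ _).
by apply/val_inj.
Qed.

Lemma is_rule_splice s Psi k : 0 <= s <= 1 -> (forall j, is_rule (Psi j)) ->
  (forall j, measurable (k @^-1` [set j])) -> is_rule (splice s Psi k).
Proof.
move=> s01 rPsi mk [|t]; first by split; [exact: measurable_cst|move=> x; exact: s01].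
split; last by move=> y; have [_ h] := rPsi (k (thead y)) t; exact: h.
(* On each of these countably many measurable cells, a single policy is followed. *)
pose E j := [set y : t.+1.-tuple X | k (thead y) = j].
have mE j : measurable (E j).
  have -> : E j = (fun y : t.+1.-tuple X => tnth y ord0) @^-1` (k @^-1` [set j]).
    by [].
  by rewrite -[X in measurable X]setTI; exact: measurable_tnth.
rewrite (_ : setT = \bigcup_j E j); last first.
  by apply/seteqP; split => // y _; exists (k (thead y)).
apply/measurable_fun_bigcup => // j.
have [mPsi _] := rPsi j t.
apply: (eq_measurable_fun (fun y : t.+1.-tuple X => Psi j t [tuple of behead y])).
  by move=> y; rewrite inE => <-.
apply: measurable_funTS.
exact: (measurableT_comp mPsi (@measurable_behead _ X t)).
Qed.

End MeasurableRules.

Section Lratio.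
Context {R : realType} {d : measure_display} {X : measurableType d}.
Variables p0 p1 : X -> R.

Lemma lratio_cons a t (y : t.-tuple X) :
  lratio p0 p1 [tuple of a :: y] = p1 a / p0 a * lratio p0 p1 y.
Proof.
rewrite /lratio big_ord_recl; congr (_ * _).
by apply: eq_bigr => i _; rewrite tnthS.
Qed.

Lemma lratio0 (y : 0.-tuple X) : lratio p0 p1 y = 1.
Proof. by rewrite /lratio big_ord0. Qed.

Hypothesis mL : measurable_fun [set: X] (fun x => p1 x / p0 x).
Hypothesis L0 : forall x, 0 <= p1 x / p0 x.

Lemma lratio_ge0 t (y : t.-tuple X) : 0 <= lratio p0 p1 y.
Proof. exact: prodr_ge0. Qed.

Lemma measurable_lratio t : measurable_fun [set: t.-tuple X] (@lratio _ _ _ p0 p1 t).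
Proof.
apply: measurable_prod => i _.
exact: (measurableT_comp mL (measurable_tnth i)).
Qed.

End Lratio.

(** * The cost of a policy *)

Section Risk.
Context {R : realType} {d : measure_display} {X : measurableType d}.
Context {d' : measure_display} {Omega : measurableType d'}.
Variables (Pr : probability Omega R) (P : probability X R).
Variable xi : nat -> Omega -> X.
Hypothesis hxi : iid Pr P xi.
Variables p0 p1 : X -> R.
Hypothesis mL : measurable_fun [set: X] (fun x => p1 x / p0 x).
Hypothesis L0 : forall x, 0 <= p1 x / p0 x.
Implicit Types psi : rule R X.

Local Notation L := (fun x => p1 x / p0 x).

Lemma measurable_comp_prefix t (h : t.-tuple X -> R) :
  measurable_fun [set: t.-tuple X] h ->
  measurable_fun [set: Omega] (fun w => h (prefix (xi^~ w) t)).
Proof.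
move=> mh.
exact: (measurableT_comp mh (@measurable_prefix _ _ _ _ _ _ _ _ hxi t)).
Qed.

Lemma measurable_stop_prob psi t : is_rule psi ->
  measurable_fun [set: Omega] (fun w => stop_prob psi (xi^~ w) t).
Proof.
move=> rpsi.
rewrite (_ : (fun w => _) = fun w => stop_tuple psi (prefix (xi^~ w) t)).
  by apply: measurable_comp_prefix; exact: measurable_stop_tuple.
by apply/funext => w; rewrite stop_tupleE.
Qed.

Lemma sum_integral_stop_prob_le1 psi : is_rule psi ->
  (\sum_(0 <= t <oo) \int[Pr]_w (stop_prob psi (xi^~ w) t)%:E <= 1)%E.
Proof.
move=> rpsi; rewrite -integral_nneseries//; last 2 first.
- by move=> t; apply/measurable_EFinP; exact: measurable_stop_prob.
- by move=> t w _; rewrite lee_fin stop_prob_ge0.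
rewrite -[leRHS](@probability_setT _ _ _ Pr) -[leRHS]mul1e -integral_cst//.
apply: ge0_le_integral => //.
- by move=> w _; apply: nneseries_ge0 => t _ _; rewrite lee_fin stop_prob_ge0.
- apply: ge0_emeasurable_sum => t.
    by move=> w _ _; rewrite lee_fin stop_prob_ge0.
  by move=> _; apply/measurable_EFinP; exact: measurable_stop_prob.
- by move=> w _; exact: nneseries_stop_prob_le1.
Qed.

(** The contribution of the event T = t to the expectation of g(z times the likelihood ratio at
    T). *)
Definition stage_gain (z : R) psi t (y : t.-tuple X) : R :=
  stop_tuple psi y * g (z * lratio p0 p1 y).

Lemma measurable_stage_gain z psi t : is_rule psi ->
  measurable_fun [set: t.-tuple X] (@stage_gain z psi t).
Proof.
move=> rpsi; apply: measurable_funM; first exact: measurable_stop_tuple.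
apply: (measurableT_comp measurable_g); apply: measurable_funM => //.
exact: measurable_lratio.
Qed.

Lemma stage_gain_ge0 z psi t (y : t.-tuple X) : 0 <= z -> is_rule psi ->
  0 <= stage_gain z psi y.
Proof.
move=> z0 rpsi; apply: mulr_ge0; first exact: stop_prob_ge0.
by apply/g_ge0/mulr_ge0 => //; exact: lratio_ge0.
Qed.

(** With [Pr] the law under H0, this is the expectation form of alpha + z beta, with no decision
    rule left in it. *)
Definition risk (z : R) psi : \bar R :=
  (\sum_(0 <= t <oo) \int[Pr]_w (stage_gain z psi (prefix (xi^~ w) t))%:E)%E.

Section RiskBounds.
Variables (z : R) (psi : rule R X).
Arguments psi : clear implicits.
Hypotheses (z0 : 0 <= z) (rpsi : is_rule psi).

Lemma integral_stage_gain_ge0 t :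
  (0 <= \int[Pr]_w (stage_gain z psi (prefix (xi^~ w) t))%:E)%E.
Proof. by apply: integral_ge0 => w _; rewrite lee_fin stage_gain_ge0. Qed.

Lemma risk_ge0 : (0 <= risk z psi)%E.
Proof. by apply: nneseries_ge0 => t _ _; exact: integral_stage_gain_ge0. Qed.

Lemma risk_le1 : (risk z psi <= 1)%E.
Proof.
apply: le_trans (sum_integral_stop_prob_le1 rpsi).
apply: lee_nneseries => t _; first by move=> _; exact: integral_stage_gain_ge0.
apply: ge0_le_integral => //.
- by move=> w _; rewrite lee_fin stage_gain_ge0.
- apply/measurable_EFinP/measurable_comp_prefix; exact: measurable_stage_gain.
- by apply/measurable_EFinP; exact: measurable_stop_prob.
- move=> w _; rewrite lee_fin /stage_gain -stop_tupleE.
  by rewrite ler_piMr ?g_le1// stop_prob_ge0.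
Qed.

Lemma risk_fin_num : risk z psi \is a fin_num.
Proof.
by rewrite ge0_fin_numE ?risk_ge0// (le_lt_trans risk_le1)// ltry.
Qed.

Lemma stage_gain_tail_ge0 x t (y : t.-tuple X) :
  0 <= stage_gain (z * L x) (tail_rule psi x) y.
Proof.
by apply: stage_gain_ge0; [exact: mulr_ge0|exact: is_rule_tail].
Qed.

Lemma measurable_stage_gain_tail t :
  measurable_fun [set: X * Omega] (fun q =>
    (stage_gain (z * L q.1) (tail_rule psi q.1) (prefix (xi^~ q.2) t))%:E).
Proof.
apply/measurable_EFinP.
(* At weight [z], [never_stop_at0 psi] has on [a :: y] the gain that [tail_rule psi a] has on [y] at
   weight [z * L a]. *)
have := measurableT_comp (measurable_stage_gain z (is_rule_never rpsi))
  (measurable_cons_prefix hxi (n := t)).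
apply: eq_measurable_fun => -[a w] _ /=.
rewrite /stage_gain stop_tuple_cons stop_prob_scons/= subr0 mul1r.
by rewrite lratio_cons mulrA -stop_tupleE.
Qed.

Lemma measurable_integral_stage_gain_tail t :
  measurable_fun [set: X] (fun x => \int[Pr]_w
    (stage_gain (z * L x) (tail_rule psi x) (prefix (xi^~ w) t))%:E)%E.
Proof.
apply: (measurable_fun_fubini_tonelli_F (m2 := Pr) (fun q : X * Omega =>
  (stage_gain (z * L q.1) (tail_rule psi q.1) (prefix (xi^~ q.2) t))%:E)).
  exact: measurable_stage_gain_tail.
by move=> q; rewrite lee_fin stage_gain_tail_ge0.
Qed.

Lemma measurable_risk_tail :
  measurable_fun [set: X] (fun x => risk (z * L x) (tail_rule psi x)).
Proof.
apply: ge0_emeasurable_sum => t.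
  move=> x _ _; apply: integral_ge0 => w _.
  by rewrite lee_fin stage_gain_tail_ge0.
by move=> _; exact: measurable_integral_stage_gain_tail.
Qed.

(** Dynamic programming: the term t = 0 is the cost of stopping at once. In the later terms
    [integral_prefixS] isolates the first observation, whose likelihood ratio is absorbed into the
    weight. *)
Lemma risk_rec :
  risk z psi = ((psi 0%N [tuple] * g z)%:E + (1 - psi 0%N [tuple])%:E *
    \int[P]_x risk (z * L x) (tail_rule psi x))%E.
Proof.
rewrite /risk nneseries_recl; last 2 first.
- by move=> t _; exact: integral_stage_gain_ge0.
- by [].
congr (_ + _)%E.
  rewrite (eq_integral (fun=> (psi 0%N [tuple] * g z)%:E)); last first.
    move=> w _; rewrite /stage_gain -stop_tupleE stop_prob0.
    by rewrite lratio0 mulr1.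
  by rewrite integral_cst//= probability_setT mule1.
rewrite -(@nneseries_addn _ (fun t => \int[Pr]_w _)%E 1); last first.
  by move=> t; exact: integral_stage_gain_ge0.
rewrite integral_nneseries//; last 2 first.
- by move=> t; exact: measurable_integral_stage_gain_tail.
- by move=> t x _; apply: integral_ge0 => w _;
  rewrite lee_fin stage_gain_tail_ge0.
rewrite -nneseriesZl; last first.
  by move=> t _; apply: integral_ge0 => x _; apply: integral_ge0 => w _;
  rewrite lee_fin stage_gain_tail_ge0.
apply: eq_eseriesr => t _; rewrite addn1.
have psi01 : (0 <= (1 - psi 0%N [tuple])%:E)%E by rewrite lee_fin subr_ge0 rule_le1.
rewrite (integral_prefixS hxi (h := fun y => (stage_gain z psi y)%:E)); last 2 first.
- by apply/measurable_EFinP; exact: measurable_stage_gain.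
- by move=> y; rewrite lee_fin stage_gain_ge0.
rewrite -ge0_integralZl//; last 2 first.
- exact: measurable_integral_stage_gain_tail.
- by move=> x _; apply: integral_ge0 => w _;
  rewrite lee_fin stage_gain_tail_ge0.
apply: eq_integral => x _.
rewrite -ge0_integralZl//; last 2 first.
- apply/measurable_EFinP/measurable_comp_prefix.
  by apply: measurable_stage_gain; exact: is_rule_tail.
- by move=> w _; rewrite lee_fin stage_gain_tail_ge0.
apply: eq_integral => w _; rewrite /stage_gain stop_tuple_cons stop_prob_scons.
by rewrite lratio_cons -EFinM stop_tupleE (mulrA z) -(mulrA (1 - _)).
Qed.

End RiskBounds.

Lemma risk_homo z z' psi : 0 <= z -> z <= z' -> is_rule psi ->
  (risk z psi <= risk z' psi)%E.
Proof.
move=> z0 zz' rpsi; have z'0 := le_trans z0 zz'.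
apply: lee_nneseries => t _; first by move=> _; exact: integral_stage_gain_ge0.
apply: ge0_le_integral => //.
- by move=> w _; rewrite lee_fin stage_gain_ge0.
- apply/measurable_EFinP/measurable_comp_prefix; exact: measurable_stage_gain.
- apply/measurable_EFinP/measurable_comp_prefix; exact: measurable_stage_gain.
- move=> w _; rewrite lee_fin ler_wpM2l ?stop_prob_ge0//.
  by apply/g_homo/ler_wpM2r => //; exact: lratio_ge0.
Qed.

End Risk.

(** * Passing from H1 to H0, and the cost as one expectation under H0 *)

Section ChangeOfMeasure.
Context {R : realType} {d : measure_display} {X : measurableType d}.
Context {d' : measure_display} {Omega : measurableType d'}.
Variables (Pr0 Pr1 : probability Omega R) (P0 P1 : probability X R).
Variable xi : nat -> Omega -> X.
Hypotheses (hH0 : iid Pr0 P0 xi) (hH1 : iid Pr1 P1 xi).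
Variables p0 p1 : X -> R.
Hypothesis mL : measurable_fun [set: X] (fun x => p1 x / p0 x).
Hypothesis L0 : forall x, 0 <= p1 x / p0 x.
Hypothesis densL : forall A, measurable A ->
  P1 A = (\int[P0]_(x in A) (p1 x / p0 x)%:E)%E.

(** Induction on t for all [h] at once: the first observation is split off under both hypotheses,
    its law is changed by the density, and the remaining ones by induction. *)
Lemma change_of_measure t (h : t.-tuple X -> \bar R) :
  measurable_fun [set: t.-tuple X] h -> (forall y, 0 <= h y)%E ->
  (\int[Pr1]_w h (prefix (xi^~ w) t) =
   \int[Pr0]_w (h (prefix (xi^~ w) t) * (lratio p0 p1 (prefix (xi^~ w) t))%:E))%E.
Proof.
elim: t h => [|t ih] h mh h0.
  rewrite (eq_integral (fun=> h [tuple])); last first.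
    by move=> w _; rewrite prefix0.
  rewrite [RHS](eq_integral (fun=> h [tuple])); last first.
    by move=> w _; rewrite prefix0 lratio0 mule1.
  by rewrite !integral_cst//= !probability_setT.
have mlr := measurable_lratio mL.
have mhc a : measurable_fun [set: t.-tuple X] (fun y : t.-tuple X => h [tuple of a :: y]).
  by apply: (measurableT_comp mh); exact: measurable_cons.
rewrite (integral_prefixS hH1)//.
rewrite (integral_prefixS hH0
  (h := fun y => h y * (lratio p0 p1 y)%:E)%E); last 2 first.
- by apply: emeasurable_funM => //; apply/measurable_EFinP; exact: mlr.
- by move=> y; rewrite mule_ge0// lee_fin lratio_ge0.
under eq_integral => a _ do rewrite (ih _ (mhc a))//.
rewrite (ge0_integral_density mL L0 densL); last 2 first.
- apply: (measurable_fun_fubini_tonelli_F (m2 := Pr0) (fun q : X * Omega =>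
    h [tuple of q.1 :: prefix (xi^~ q.2) t] * (lratio p0 p1 (prefix (xi^~ q.2) t))%:E)%E).
    apply: emeasurable_funM.
      exact: (measurableT_comp mh (@measurable_cons_prefix _ _ _ _ _ _ _ _ hH0 t)).
    apply/measurable_EFinP.
    apply: (measurableT_comp (mlr t)).
    exact: (measurableT_comp (@measurable_prefix _ _ _ _ _ _ _ _ hH0 t) measurable_snd).
  by move=> q; rewrite mule_ge0// lee_fin lratio_ge0.
- by move=> a; apply: integral_ge0 => w _; rewrite mule_ge0// lee_fin lratio_ge0.
apply: eq_integral => a _; rewrite muleC -ge0_integralZl//; last 3 first.
- apply: emeasurable_funM.
    exact: (measurableT_comp (mhc a) (@measurable_prefix _ _ _ _ _ _ _ _ hH0 t)).
  apply/measurable_EFinP; exact: (measurable_comp_prefix hH0 (mlr t)).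
- by move=> w _; rewrite mule_ge0// lee_fin lratio_ge0.
- by rewrite lee_fin L0.
apply: eq_integral => w _; rewrite lratio_cons EFinM.
by rewrite muleCA.
Qed.

Lemma integral_ratio : (\int[P0]_x (p1 x / p0 x)%:E = 1)%E.
Proof. by rewrite -densL// probability_setT. Qed.

(** Since g is 1-Lipschitz, the increase is at most z' - z times the H0-expectation of the
    likelihood ratio at T on T < oo; by change of measure this is the probability of T < oo under
    H1, at most 1. *)
Lemma risk_lipschitz z z' psi : 0 <= z -> z <= z' -> is_rule psi ->
  (risk Pr0 xi p0 p1 z' psi <= risk Pr0 xi p0 p1 z psi + (z' - z)%:E)%E.
Proof.
move=> z0 zz' rpsi; have z'0 := le_trans z0 zz'.
have dz0 : 0 <= z' - z by rewrite subr_ge0.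
have mlr t := measurable_comp_prefix hH0 (measurable_lratio mL (t := t)).
have mS t := measurable_stop_prob hH0 t rpsi.
have S0 w t : 0 <= stop_prob psi (xi^~ w) t by exact: stop_prob_ge0.
have lr0 w t : 0 <= lratio p0 p1 (prefix (xi^~ w) t) by exact: lratio_ge0.
have Sl0 t : (0 <= \int[Pr0]_w
    (stop_prob psi (xi^~ w) t * lratio p0 p1 (prefix (xi^~ w) t))%:E)%E.
  by apply: integral_ge0 => w _; rewrite lee_fin mulr_ge0.
have le1 : (\sum_(0 <= t <oo) \int[Pr0]_w
    (stop_prob psi (xi^~ w) t * lratio p0 p1 (prefix (xi^~ w) t))%:E <= 1)%E.
  apply: le_trans (sum_integral_stop_prob_le1 hH1 rpsi).
  rewrite (eq_eseriesr (g := fun t => \int[Pr1]_w (stop_prob psi (xi^~ w) t)%:E)%E)//.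
  move=> t _; under [RHS]eq_integral do rewrite stop_tupleE.
  rewrite (@change_of_measure t (fun y => (stop_tuple psi y)%:E)).
  - by apply: eq_integral => w _; rewrite EFinM stop_tupleE.
  - by apply/measurable_EFinP; exact: measurable_stop_tuple.
  - by move=> y; rewrite lee_fin; exact: stop_prob_ge0.
rewrite -[X in (_ <= _ + X)%E]mule1.
apply: (le_trans _ (leeD2l _ (lee_wpmul2l _ le1))); last by rewrite lee_fin.
rewrite -nneseriesZl// /risk -nneseriesD//; last 2 first.
- by move=> t _ _; exact: integral_stage_gain_ge0.
- by move=> t _ _; rewrite mule_ge0// lee_fin.
apply: lee_nneseries => t _.
  by move=> _; exact: integral_stage_gain_ge0.
have mG : measurable_fun [set: Omega]
    (fun w => (stage_gain p0 p1 z psi (prefix (xi^~ w) t))%:E).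
  apply/measurable_EFinP/(measurable_comp_prefix hH0).
  exact: measurable_stage_gain.
have mSl : measurable_fun [set: Omega] (fun w =>
    (stop_prob psi (xi^~ w) t * lratio p0 p1 (prefix (xi^~ w) t))%:E).
  by apply/measurable_EFinP; exact: measurable_funM.
rewrite -ge0_integralZl//; last first.
  by move=> w _; rewrite lee_fin mulr_ge0.
rewrite -ge0_integralD//; last 3 first.
- by move=> w _; rewrite lee_fin stage_gain_ge0.
- by move=> w _; rewrite mule_ge0// lee_fin mulr_ge0.
- exact: measurable_funeM.
apply: ge0_le_integral => //.
- by move=> w _; rewrite lee_fin stage_gain_ge0.
- apply/measurable_EFinP/(measurable_comp_prefix hH0).
  exact: measurable_stage_gain.
- by apply: emeasurable_funD => //; exact: measurable_funeM.
move=> w _; rewrite -EFinM -EFinD lee_fin /stage_gain -stop_tupleE.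
rewrite mulrCA -mulrDr ler_wpM2l//.
rewrite (le_trans (g_lipschitz (ler_wpM2r (lr0 w t) zz')))//.
by rewrite mulrBl.
Qed.

Section Cost.
Variable tie : R -> rule R X -> rule R X.
Hypothesis htie : forall (z : R) psi, 0 <= z -> is_rule psi -> is_rule (tie z psi).

Lemma is_rule_decision z psi : 0 <= z -> is_rule psi ->
  is_rule (Defs.decision p0 p1 (tie z psi) z).
Proof.
move=> z0 rpsi t; have [mt t01] := htie z0 rpsi t; split; last first.
  move=> y; rewrite /Defs.decision; case: ifP => _; first by rewrite ler01 lexx.
  by case: ifP => _; [rewrite lexx ler01|exact: t01].
have mzl : measurable_fun [set: t.-tuple X] (fun y : t.-tuple X => z * lratio p0 p1 y).
  by apply: measurable_funM => //; exact: measurable_lratio.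
apply: measurable_fun_ifT; [exact: measurable_fun_ltr|exact: measurable_cst|].
by apply: measurable_fun_ifT; [exact: measurable_fun_ltr|exact: measurable_cst|exact: mt].
Qed.

(** Once the type II error is written under H0, the likelihood ratio decision realizes the pointwise
    minimum of 1 and z l, where l is the likelihood ratio. *)
Lemma cost_risk z psi : 0 <= z -> is_rule psi ->
  cost Pr0 Pr1 xi p0 p1 tie z psi = fine (risk Pr0 xi p0 p1 z psi).
Proof.
move=> z0 rpsi; rewrite /cost /type1_error /type2_error /stop_and_decide.
have rdec := is_rule_decision z0 rpsi.
set dec := Defs.decision _ _ _ _.
set A := (X in fine X + _); set B := (X in _ + z * fine X).
have S0 w t : 0 <= stop_prob psi (xi^~ w) t by exact: stop_prob_ge0.
have d0 t y : 0 <= dec t y by exact: rule_ge0.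
have d1 t y : 0 <= 1 - dec t y by rewrite subr_ge0 rule_le1.
have lr0 w t : 0 <= lratio p0 p1 (prefix (xi^~ w) t) by exact: lratio_ge0.
have mS t : measurable_fun [set: t.-tuple X] (@stop_tuple _ _ _ psi t).
  exact: measurable_stop_tuple.
have md t : measurable_fun [set: t.-tuple X] (dec t) by have [] := rdec t.
have mdC t : measurable_fun [set: t.-tuple X] (fun y => 1 - dec t y).
  by apply: (measurable_funB (f := fun=> 1)) (md t).
pose A' t := (\int[Pr0]_w (stop_prob psi (xi^~ w) t * dec t (prefix (xi^~ w) t))%:E)%E.
pose B' t := (\int[Pr0]_w (stop_prob psi (xi^~ w) t * (1 - dec t (prefix (xi^~ w) t))
   * lratio p0 p1 (prefix (xi^~ w) t))%:E)%E.
have SC0 t w : 0 <= stop_prob psi (xi^~ w) t * (1 - dec t (prefix (xi^~ w) t)).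
  by apply: mulr_ge0; [exact: S0|exact: d1].
have A'0 t : (0 <= A' t)%E.
  by apply: integral_ge0 => w _; rewrite lee_fin mulr_ge0.
have B'0 t : (0 <= B' t)%E.
  by apply: integral_ge0 => w _; rewrite lee_fin mulr_ge0.
have AE : A = (\sum_(0 <= t <oo) A' t)%E.
  by apply: eq_eseriesr => t _; rewrite unlock.
have BE : B = (\sum_(0 <= t <oo) B' t)%E.
  apply: eq_eseriesr => t _; rewrite unlock /B'.
  under eq_integral do rewrite stop_tupleE.
  rewrite (@change_of_measure t (fun y => (stop_tuple psi y * (1 - dec t y))%:E)).
  - by apply: eq_integral => w _; rewrite [in RHS]EFinM stop_tupleE.
  - by apply/measurable_EFinP; exact: (measurable_funM (mS t) (mdC t)).
  - by move=> y; rewrite lee_fin mulr_ge0//; exact: stop_prob_ge0.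
have riskE : risk Pr0 xi p0 p1 z psi = (A + z%:E * B)%E.
  rewrite AE BE -nneseriesZl// -nneseriesD//; last first.
    by move=> t _ _; rewrite mule_ge0// lee_fin.
  apply: eq_eseriesr => t _.
  have mA : measurable_fun [set: Omega]
      (fun w => (stop_prob psi (xi^~ w) t * dec t (prefix (xi^~ w) t))%:E).
    apply/measurable_EFinP.
    exact: (measurable_funM (measurable_stop_prob hH0 t rpsi)
              (measurable_comp_prefix hH0 (md t))).
  have mB : measurable_fun [set: Omega]
      (fun w => (stop_prob psi (xi^~ w) t * (1 - dec t (prefix (xi^~ w) t))
        * lratio p0 p1 (prefix (xi^~ w) t))%:E).
    apply/measurable_EFinP.
    exact: (measurable_funM (measurable_funM (measurable_stop_prob hH0 t rpsi)
      (measurable_comp_prefix hH0 (mdC t)))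
      (measurable_comp_prefix hH0 (measurable_lratio mL (t := t)))).
  rewrite /A' /B' -ge0_integralZl//; last first.
    by move=> w _; rewrite lee_fin mulr_ge0.
  rewrite -ge0_integralD//; last 3 first.
  - by move=> w _; rewrite lee_fin mulr_ge0.
  - by move=> w _; rewrite mule_ge0// lee_fin mulr_ge0.
  - exact: measurable_funeM.
  apply: eq_integral => w _; rewrite -EFinM -EFinD; congr EFin.
  rewrite /stage_gain -stop_tupleE /dec /Defs.decision /g minElt.
  set l := lratio _ _ _; set s := stop_prob _ _ _.
  have -> b : z * (s * b * l) = s * b * (z * l) by ring.
  (* In the last case z l = 1, and both decisions have the same cost. *)
  by case: ltgtP => [_|_|<-]; ring.
have rfin := risk_fin_num hH0 mL L0 z0 rpsi.
have A0 : (0 <= A)%E by rewrite AE; apply: nneseries_ge0 => t _ _; exact: A'0.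
have B0 : (0 <= B)%E by rewrite BE; apply: nneseries_ge0 => t _ _; exact: B'0.
(* [fine] is additive on finite values only: [B] is bounded by the probability of stopping under H1,
   and [A] by the risk. *)
have Bfin : B \is a fin_num.
  rewrite ge0_fin_numE//; apply: le_lt_trans (ltry 1).
  apply: le_trans (sum_integral_stop_prob_le1 hH1 rpsi).
  apply: lee_nneseries => t _.
    by move=> _; apply: expectation_ge0 => w; rewrite mulr_ge0.
  rewrite unlock; apply: ge0_le_integral => //.
  - by move=> w _; rewrite lee_fin mulr_ge0.
  - apply/measurable_EFinP.
    exact: (measurable_funM (measurable_stop_prob hH1 t rpsi)
              (measurable_comp_prefix hH1 (mdC t))).
  - by apply/measurable_EFinP; exact: (measurable_stop_prob hH1).
  - by move=> w _; rewrite lee_fin ler_piMr// gerBl.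
have Afin : A \is a fin_num.
  rewrite ge0_fin_numE//; apply: le_lt_trans (_ : (risk Pr0 xi p0 p1 z psi < +oo)%E).
    by rewrite riskE leeDl// mule_ge0// lee_fin.
  by rewrite -ge0_fin_numE// risk_ge0.
by rewrite riskE fineD ?fin_numM// fineM.
Qed.

End Cost.
End ChangeOfMeasure.

(** * The integral equation *)

Section Attained.
Context {R : realType}.

Lemma lipschitz_continuous (F : R -> R) (K : R) : 0 < K ->
  (forall b b', `|F b - F b'| <= K * `|b - b'|) -> continuous F.
Proof.
move=> K0 FK b; apply/cvgrPdist_lt => e e0.
near=> b'; apply: le_lt_trans (FK _ _) _.
rewrite mulrC -ltr_pdivlMr//.
near: b'; apply: cvgr_dist_lt => //; exact: divr_gt0.
Unshelve. all: by end_near. Qed.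

(** The ratio is continuous and at most 1 / b. If it is positive somewhere, large b cannot compete
    and the extreme value theorem applies on a compact interval; otherwise b = m is a maximizer, the
    ratio there being nonnegative. *)
Lemma max_ratio_attained (E : R -> R) (a m : R) :
  0 <= a <= 1 -> 1 <= m -> (forall b, m <= b -> 0 <= E b <= a) ->
  (forall b b', m <= b -> b <= b' -> E b' <= E b <= E b' + (b' - b)) ->
  exists2 b, m <= b & forall b', m <= b' -> (a - E b') / b' <= (a - E b) / b.
Proof.
move=> /andP[a0 a1] m1 E0a Elip; pose F b := (a - E b) / b.
(* In the numerator below, the first product is at most b' - b as a <= 1, the second at most b (b' -
   b), and the denominator is at least b >= 1. *)
have Flip b b' : m <= b -> b <= b' -> `|F b - F b'| <= 2 * (b' - b).
  move=> mb bb'; have b1 : 1 <= b by lra.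
  have [b0 b'0] : 0 < b /\ 0 < b' by lra.
  have /andP[Eb0 Eba] := E0a _ mb.
  have /andP[E1 E2] := Elip _ _ mb bb'.
  have -> : F b - F b' = ((a - E b) * (b' - b) - b * (E b - E b')) / (b * b').
    by rewrite /F; field; rewrite !gt_eqF.
  have bb'0 : 0 < b * b' by exact: mulr_gt0.
  rewrite normrM normfV (gtr0_norm bb'0) ler_pdivrMr//.
  have bb1 : b <= b * b' by nra.
  rewrite ler_norml; apply/andP; split; nra.
have [|] := pselect (forall b, m <= b -> F b <= 0).
  move=> F0; exists m => // b mb; apply: le_trans (F0 _ mb) _.
  have /andP[_ ?] := E0a m (lexx m).
  by rewrite divr_ge0; lra.
move=> /existsNP[b0 /not_implyP[mb0 /negP]]; rewrite -ltNge => Fb0.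
(* Beyond 1 / F(b0), the bound F(b) <= 1 / b gives F(b) <= F(b0). *)
pose B := Num.max b0 (F b0)^-1.
have mB : m <= B by rewrite le_max mb0.
(* Extending [F] by a constant to the left of [m] yields continuity on the whole line. *)
pose G b := F (Num.max m b).
have Gc : continuous G.
  apply: (@lipschitz_continuous _ 2) => // b b'.
  wlog bb' : b b' / b <= b'.
    move=> h; have [/h//|/ltW/h] := leP b b'.
    by rewrite distrC [in leRHS]distrC.
  rewrite (distrC b) (ger0_norm (_ : 0 <= b' - b)) ?subr_ge0//.
  apply: le_trans (Flip _ _ _ _) _; first by rewrite le_max lexx.
    by rewrite ge_max !le_max lexx/= bb' orbT.
  rewrite ler_pM2l// !maxEle; case: (leP m b) => h1; case: (leP m b') => h2; lra.
have [b bmB bmax] := EVT_max mB (continuous_subspaceT Gc).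
have GE x : m <= x -> G x = F x by move=> mx; rewrite /G; case: ltgtP mx => // ->.
move: bmB; rewrite in_itv/= => /andP[mb bB].
have Fb : F b0 <= F b.
  by rewrite -!GE//; apply: bmax; rewrite in_itv/= mb0 le_max lexx.
exists b => // b' mb'; have [b'B|Bb'] := leP b' B.
  by rewrite -/(F b') -/(F b) -!GE//; apply: bmax; rewrite in_itv/= mb'.
apply: le_trans Fb; have b'0 : 0 < b' by lra.
have /andP[? ?] := E0a _ mb'.
rewrite ler_pdivrMr//; apply: (@le_trans _ _ 1); first lra.
have : (F b0)^-1 <= b' by apply: le_trans (ltW Bb'); rewrite le_max lexx orbT.
by rewrite -(@ler_pM2l _ (F b0))// mulfV ?gt_eqF.
Qed.

End Attained.

Section Mean.
Context {R : realType} {d : measure_display} {X : measurableType d}.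
Variable P : probability X R.

Lemma bounded_integrable (u : X -> R) : measurable_fun [set: X] u ->
  (forall x, 0 <= u x <= 1) -> P.-integrable [set: X] (EFin \o u).
Proof.
move=> mu u01; apply: (@le_integrable _ _ _ _ _ measurableT _ (cst 1%E)).
- exact/measurable_EFinP.
- move=> x _ /=; have /andP[u0 u1] := u01 x.
  by rewrite lee_fin ger0_norm// normr1.
- exact: finite_measure_integrable_cst.
Qed.

(** The unlocked form of the expectation in [is_solution]. *)
Definition mean (u : X -> R) : R := fine (\int[P]_x (u x)%:E).

Lemma meanE u : P.-integrable [set: X] (EFin \o u) ->
  (mean u)%:E = (\int[P]_x (u x)%:E)%E.
Proof. by move=> iu; rewrite fineK// integrable_fin_num. Qed.

Lemma le_mean u v k : P.-integrable [set: X] (EFin \o u) ->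
  P.-integrable [set: X] (EFin \o v) -> (forall x, u x <= v x + k) ->
  mean u <= mean v + k.
Proof.
move=> iu iv uvk; rewrite -lee_fin EFinD !meanE//.
have ik : P.-integrable [set: X] (EFin \o fun=> k).
  exact: finite_measure_integrable_cst.
have -> : k%:E = (\int[P]_x (k)%:E)%E.
  by rewrite integral_cst//= probability_setT mule1.
rewrite -integralD//; apply: le_integral => //; first exact: integrableD.
by move=> x _; rewrite -EFinD lee_fin.
Qed.

End Mean.

(** * How the first observation consumes the budget *)

Section Budget.
Context {R : realType} {d : measure_display} {X : measurableType d}.
Implicit Types (psi : rule R X) (c : R).

Lemma budget_policiesP psi c : is_rule psi ->
  budget_policies c psi <->
  forall x n, \sum_(0 <= t < n) survival psi x t.+1 <= c.
Proof.
move=> rpsi; split=> [[_ bpsi] x n|bpsi]; first exact: mean_time_le_survival.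
by split=> // x; apply: survival_le_mean_time.
Qed.

(** First-step analysis of the expected stopping time: continuing costs one observation plus the
    time of the tail policy. *)
Lemma sum_survival_scons psi a x n :
  \sum_(0 <= t < n.+1) survival psi (scons a x) t.+1 =
  (1 - psi 0%N [tuple]) * (1 + \sum_(0 <= t < n) survival (tail_rule psi a) x t.+1).
Proof.
under eq_bigr do rewrite survival_scons.
by rewrite -mulr_sumr big_nat_recl// survival0.
Qed.

Lemma scons_eta (x : nat -> X) : x = scons (x 0%N) (fun n => x n.+1).
Proof. by apply/funext => -[]. Qed.

Lemma budget_policiesS c c' : c <= c' ->
  budget_policies c `<=` (budget_policies c' : set (rule R X)).
Proof.
move=> cc' psi [rpsi bpsi]; split=> // x.
by apply: le_trans (bpsi x) _; rewrite lee_fin.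
Qed.

Definition always_stop : rule R X := fun _ _ => 1.

Lemma always_stop_budget c : 0 <= c -> budget_policies c always_stop.
Proof.
move=> c0; have r1 : is_rule always_stop.
  by move=> t; split=> [|x]; [exact: measurable_cst|rewrite ler01 lexx].
apply/budget_policiesP => // x n; rewrite big1// => t _.
by rewrite survivalS subrr mulr0.
Qed.

(** Continuing with probability c / b, then spending 1 + (b - 1) at most, costs at most c on every
    path. *)
Lemma splice_budget s (Psi : nat -> rule R X) k c b : 0 < c -> 1 <= b -> c <= b ->
  s = 1 - c / b -> (forall j, budget_policies (b - 1) (Psi j)) ->
  (forall j, measurable (k @^-1` [set j])) ->
  budget_policies c (splice s Psi k).
Proof.
move=> c0 b1 cb sE bPsi mk; have b0 : 0 < b by lra.
have rs : is_rule (splice s Psi k).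
  apply: is_rule_splice => //; last by move=> j; case: (bPsi j).
  have cb0 : 0 <= c / b by rewrite divr_ge0// ltW.
  have cb1 : c / b <= 1 by rewrite ler_pdivrMr// mul1r.
  by rewrite sE; apply/andP; split; lra.
apply/budget_policiesP => // x [|n]; first by rewrite big_geq// ltW.
rewrite (scons_eta x) sum_survival_scons tail_splice /= sE subKr.
rewrite mulrAC ler_pdivrMr// ler_pM2l//.
have [rj bj] := bPsi (k (x 0%N)).
have := mean_time_le_survival rj n (bj (fun n => x n.+1)); lra.
Qed.

(** The converse of [splice_budget], with b = c / (1 - psi_0). *)
Lemma tail_budget psi c a : budget_policies c psi -> 0 < c ->
  psi 0%N [tuple] < 1 ->
  budget_policies (c / (1 - psi 0%N [tuple]) - 1) (tail_rule psi a).
Proof.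
move=> [rpsi bpsi] c0 psi1; apply/budget_policiesP; first exact: is_rule_tail.
move=> x n; have := mean_time_le_survival rpsi n.+1 (bpsi (scons a x)).
have s0 : 0 < 1 - psi 0%N [tuple] by lra.
rewrite sum_survival_scons mulrC -ler_pdivlMr//; lra.
Qed.

Lemma stop_at0_budget psi c : budget_policies c psi -> 1 - psi 0%N [tuple] <= c.
Proof.
move=> [rpsi bpsi]; have := mean_time_le_survival rpsi 1 (bpsi (fun=> point)).
by rewrite big_nat1 survivalS survival0 mul1r prefix0.
Qed.

End Budget.

(** * The minimal cost solves the equation *)

Section Rho.
Context {R : realType} {d : measure_display} {X : measurableType d}.
Context {d' : measure_display} {Omega : measurableType d'}.
Variables (Pr0 Pr1 : probability Omega R) (P0 P1 : probability X R).
Variable xi : nat -> Omega -> X.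
Hypotheses (hH0 : iid Pr0 P0 xi) (hH1 : iid Pr1 P1 xi).
Variables p0 p1 : X -> R.
Hypothesis mL : measurable_fun [set: X] (fun x => p1 x / p0 x).
Hypothesis L0 : forall x, 0 <= p1 x / p0 x.
Hypothesis densL : forall A, measurable A ->
  P1 A = (\int[P0]_(x in A) (p1 x / p0 x)%:E)%E.
Variable tie : R -> rule R X -> rule R X.
Hypothesis htie : forall (z : R) psi, 0 <= z -> is_rule psi -> is_rule (tie z psi).

Implicit Types z c e : R.

Local Notation L := (fun x => p1 x / p0 x).
Local Notation rho := (Defs.rho Pr0 Pr1 xi p0 p1 tie).
Local Notation rsk z psi := (fine (risk Pr0 xi p0 p1 z psi)).

Lemma risk_fineK z psi : 0 <= z -> is_rule psi ->
  (rsk z psi)%:E = risk Pr0 xi p0 p1 z psi.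
Proof. by move=> z0 rpsi; rewrite fineK// (risk_fin_num hH0). Qed.

Lemma rho_lbound z c : 0 <= z ->
  lbound [set cost Pr0 Pr1 xi p0 p1 tie z psi | psi in budget_policies c] 0.
Proof.
move=> z0 _ [psi [rpsi _] <-].
by rewrite (cost_risk hH0 hH1 mL L0 densL htie)// fine_ge0// risk_ge0.
Qed.

Lemma rho_le z c psi : 0 <= z -> budget_policies c psi ->
  rho z c <= rsk z psi.
Proof.
move=> z0 bpsi; apply: ge_inf; first by exists 0; exact: rho_lbound.
by exists psi => //; have [rpsi _] := bpsi; rewrite (cost_risk hH0 hH1 mL L0 densL htie).
Qed.

Lemma le_rho z c y : 0 <= z -> 0 <= c ->
  (forall psi, budget_policies c psi -> y <= rsk z psi) -> y <= rho z c.
Proof.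
move=> z0 c0 yle; apply: lb_le_inf.
  exact/image_nonempty/(ex_intro _ _ (always_stop_budget c0)).
move=> _ [psi bpsi <-]; have [rpsi _] := bpsi.
by rewrite (cost_risk hH0 hH1 mL L0 densL htie)//; exact: yle.
Qed.

Lemma rho_adherent z c e : 0 <= z -> 0 <= c -> 0 < e ->
  exists2 psi, budget_policies c psi & rsk z psi < rho z c + e.
Proof.
move=> z0 c0 e0; have [|y [psi bpsi <-] ye] := @inf_adherent _
    [set cost Pr0 Pr1 xi p0 p1 tie z psi | psi in budget_policies c] e e0.
  split; last by exists 0; exact: rho_lbound.
  exact/image_nonempty/(ex_intro _ _ (always_stop_budget c0)).
exists psi => //; have [rpsi _] := bpsi.
by rewrite -(cost_risk hH0 hH1 mL L0 densL htie).
Qed.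

Lemma rho_ge0 z c : 0 <= z -> 0 <= c -> 0 <= rho z c.
Proof.
by move=> z0 c0; apply: le_rho => // psi [rpsi _]; rewrite fine_ge0// risk_ge0.
Qed.

Lemma stop_at0_risk z psi : 0 <= z -> is_rule psi -> psi 0%N [tuple] = 1 ->
  rsk z psi = g z.
Proof.
move=> z0 rpsi psi1; rewrite (risk_rec hH0 mL L0 z0 rpsi) psi1.
by rewrite subrr mul0e adde0 mul1r.
Qed.

Lemma rho_le_g z c : 0 <= z -> 0 <= c -> rho z c <= g z.
Proof.
move=> z0 c0; have bs := @always_stop_budget R d X c c0.
by rewrite -(stop_at0_risk z0 (proj1 bs))//; exact: rho_le.
Qed.

Lemma rho_0 z : 0 <= z -> rho z 0 = g z.
Proof.
move=> z0; apply/eqP; rewrite eq_le rho_le_g//=.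
apply: le_rho => // psi bpsi; have [rpsi _] := bpsi.
rewrite stop_at0_risk//; apply/eqP; rewrite eq_le rule_le1//=.
by have := stop_at0_budget bpsi; lra.
Qed.

Lemma rho_homo c z z' : 0 <= c -> 0 <= z -> z <= z' -> rho z c <= rho z' c.
Proof.
move=> c0 z0 zz'; have z'0 := le_trans z0 zz'.
apply: le_rho => // psi bpsi; have [rpsi _] := bpsi.
apply: le_trans (rho_le z0 bpsi) _.
by rewrite -lee_fin !risk_fineK//; exact: (risk_homo hH0).
Qed.

Lemma rho_anti z c c' : 0 <= z -> 0 <= c -> c <= c' -> rho z c' <= rho z c.
Proof.
move=> z0 c0 cc'; apply: le_rho => // psi bpsi; apply: rho_le => //.
exact: budget_policiesS cc' _ bpsi.
Qed.

(** [rho] is monotone in its first argument, hence Borel; clamping at 0 makes this monotonicity hold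
    on the whole line. *)
Lemma measurable_rho_ratio z c : 0 <= z -> 0 <= c ->
  measurable_fun [set: X] (fun x => rho (z * L x) c).
Proof.
move=> z0 c0.
have mr : measurable_fun [set: R] (fun y => rho (Num.max 0 y) c).
  apply: nondecreasing_measurable => // y y' yy'.
  apply: rho_homo => //; first by rewrite le_max lexx.
  by rewrite ge_max !le_max lexx yy' orbT.
have mz : measurable_fun [set: X] (fun x => z * L x) by exact: measurable_funM.
apply: eq_measurable_fun (measurableT_comp mr mz) => x _ /=.
by rewrite max_r// mulr_ge0.
Qed.

Lemma integrable_rho z c : 0 <= z -> 0 <= c ->
  P0.-integrable [set: X] (EFin \o fun x => rho (z * L x) c).
Proof.
move=> z0 c0; apply: bounded_integrable; first exact: measurable_rho_ratio.
move=> x; have zL0 : 0 <= z * L x by exact: mulr_ge0.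
by rewrite rho_ge0//= (le_trans (rho_le_g zL0 c0))// g_le1.
Qed.

Definition continuation z c : R := mean P0 (fun x => rho (z * L x) c).

Lemma continuation_ge0 z c : 0 <= z -> 0 <= c -> 0 <= continuation z c.
Proof.
move=> z0 c0; apply: fine_ge0; apply: integral_ge0 => x _.
by rewrite lee_fin rho_ge0// mulr_ge0.
Qed.

(* Jensen's inequality for [g], as the likelihood ratio has mean 1 under P0. *)
Lemma continuation_le_g z c : 0 <= z -> 0 <= c -> continuation z c <= g z.
Proof.
move=> z0 c0; have zL0 x : 0 <= z * L x by exact: mulr_ge0.
have mE : measurable_fun [set: X] (fun x => (rho (z * L x) c)%:E).
  by apply/measurable_EFinP; exact: measurable_rho_ratio.
rewrite /g le_min -!lee_fin /continuation meanE; last exact: integrable_rho.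
apply/andP; split.
  have -> : 1%E = (\int[P0]_x (cst 1%:E) x)%E.
    by rewrite integral_cst//= probability_setT mule1.
  apply: ge0_le_integral => //.
  - by move=> x _; rewrite lee_fin rho_ge0.
  - by move=> x _; rewrite lee_fin (le_trans (rho_le_g (zL0 x) c0))// g_le1.
rewrite -[leRHS]mule1 -(integral_ratio densL) -ge0_integralZl//; last 2 first.
- exact/measurable_EFinP.
- by move=> x _; rewrite lee_fin.
apply: ge0_le_integral => //.
- by move=> x _; rewrite lee_fin rho_ge0.
- by apply: measurable_funeM; exact/measurable_EFinP.
- by move=> x _; rewrite -EFinM lee_fin (le_trans (rho_le_g (zL0 x) c0))// g_le.
Qed.

Lemma continuation_le z : 0 <= z -> forall K c c', 0 <= c -> 0 <= c' ->
  (forall y, 0 <= y -> rho y c <= rho y c' + K) ->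
  continuation z c <= continuation z c' + K.
Proof.
move=> z0 K c c' c0 c'0 hK; apply: le_mean; [exact: integrable_rho..|].
by move=> x; apply: hK; exact: mulr_ge0.
Qed.

(* One observation is bought with probability [c / b]; the rest of the budget
   then goes to near-optimal policies selected on a grid of posterior odds. *)
Lemma rho_le_continuation z c b : 0 <= z -> 0 < c -> 1 <= b -> c <= b ->
  rho z c <= (1 - c / b) * g z + c / b * continuation z (b - 1).
Proof.
move=> z0 c0 b1 cb; have b0 : 0 < b by lra.
have bm0 : 0 <= b - 1 by lra.
have cb0 : 0 <= c / b by rewrite divr_ge0// ltW.
have cb1 : c / b <= 1 by rewrite ler_pdivrMr// mul1r.
(* The error e is shared between the mesh [h] of the grid and the suboptimality [h] of the selected
   policies. *)
apply/ler_addgt0Pr => e e0; pose h := e / 2; have h0 : 0 < h by rewrite /h; lra.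
have zL0 x : 0 <= z * L x by exact: mulr_ge0.
have jh0 (j : nat) : 0 <= j%:R * h by rewrite mulr_ge0// ltW.
have /choice[Psi PsiP] (j : nat) : exists psi, budget_policies (b - 1) psi /\
    rsk (j%:R * h) psi < rho (j%:R * h) (b - 1) + h.
  by have [psi ? ?] := rho_adherent (jh0 j) bm0 h0; exists psi.
pose k x := Num.truncn (z * L x / h).
have kP x : (k x)%:R * h <= z * L x < (k x).+1%:R * h.
  rewrite -ler_pdivlMr// -ltr_pdivrMr//; apply: truncn_itv.
  by rewrite divr_ge0// ltW.
have mk j : measurable (k @^-1` [set j]).
  have mzL : measurable_fun [set: X] (fun x => z * L x / h).
    by apply: measurable_funM => //; exact: measurable_funM.
  have -> : k @^-1` [set j] = (fun x => z * L x / h) @^-1` `[j%:R, j.+1%:R[%classic.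
    apply/seteqP; split=> x /=; rewrite in_itv/=.
      by move=> <-; apply: truncn_itv; rewrite divr_ge0// ltW.
    exact: truncn_def.
  by rewrite -[X in measurable X]setTI; exact: mzL.
have bPsi j : budget_policies (b - 1) (Psi j) by case: (PsiP j).
have rPsi j : is_rule (Psi j) by case: (bPsi j).
have bs := splice_budget c0 b1 cb erefl bPsi mk.
have [rs _] := bs.
apply: le_trans (rho_le z0 bs) _.
have IE : (\int[P0]_x risk Pr0 xi p0 p1 (z * L x) (Psi (k x)) <=
    (continuation z (b - 1) + e)%:E)%E.
  have -> : (continuation z (b - 1) + e)%:E =
      (\int[P0]_x ((rho (z * L x) (b - 1))%:E + e%:E))%E.
    rewrite integralD//; [|exact: integrable_rho|exact: finite_measure_integrable_cst].
    rewrite EFinD meanE; last exact: integrable_rho.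
    by rewrite integral_cst//= probability_setT mule1.
  have mrisk := measurable_risk_tail hH0 mL L0 z0 rs.
  apply: ge0_le_integral => //.
  - by move=> x _; exact: risk_ge0.
  - by apply: eq_measurable_fun mrisk => x _; rewrite tail_splice.
  - by apply: emeasurable_funD => //; apply/measurable_EFinP; exact: measurable_rho_ratio.
  move=> x _; have /andP[kx1 kx2] := kP x.
  have [_ nearopt] := PsiP (k x).
  (* Moving up from the grid point costs less than [h], near-optimality there another [h], and [rho]
     at the grid point is at most [rho] at [z * L x]. *)
  apply: le_trans (risk_lipschitz hH0 hH1 mL L0 densL (jh0 _) kx1 (rPsi _)) _.
  rewrite -risk_fineK// -!EFinD lee_fin.
  have := rho_homo bm0 (jh0 (k x)) kx1.
  move: kx2 nearopt; rewrite -natr1 mulrDl mul1r /h; lra.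
rewrite -lee_fin risk_fineK// (risk_rec hH0 mL L0 z0 rs) /= subKr.
under eq_integral do rewrite tail_splice.
apply: (@le_trans _ _ (((1 - c / b) * g z)%:E +
    (c / b)%:E * (continuation z (b - 1) + e)%:E)%E).
  by rewrite leeD2l// lee_wpmul2l ?lee_fin.
rewrite -EFinM -EFinD lee_fin mulrDr addrA lerD2l.
by rewrite ler_piMl// ltW.
Qed.

Lemma risk_ge_continuation z c psi : 0 <= z -> 0 < c -> budget_policies c psi ->
  psi 0%N [tuple] < 1 -> exists b, [/\ 1 <= b, c <= b &
  (1 - c / b) * g z + c / b * continuation z (b - 1) <= rsk z psi].
Proof.
move=> z0 c0 bpsi psi1; have [rpsi _] := bpsi.
have s0 : 0 < 1 - psi 0%N [tuple] by lra.
have psi0 : 0 <= psi 0%N [tuple] by exact: rule_ge0.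
(* This makes c / b the probability of continuing at time 0, and leaves every tail policy the budget
   b - 1. *)
exists (c / (1 - psi 0%N [tuple])).
have b1 : 1 <= c / (1 - psi 0%N [tuple]).
  by rewrite ler_pdivlMr// mul1r; exact: stop_at0_budget.
have bm0 : 0 <= c / (1 - psi 0%N [tuple]) - 1 by lra.
split=> //.
  rewrite ler_pdivlMr// ler_piMr ?gerBl//; exact: ltW.
have -> : c / (c / (1 - psi 0%N [tuple])) = 1 - psi 0%N [tuple].
  by rewrite invf_div mulrC divfK// gt_eqF.
rewrite subKr -lee_fin risk_fineK// (risk_rec hH0 mL L0 z0 rpsi).
rewrite EFinD leeD2l// EFinM lee_wpmul2l ?lee_fin ?(ltW s0)//.
rewrite meanE; last exact: integrable_rho.
apply: ge0_le_integral => //.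
- by move=> x _; rewrite lee_fin rho_ge0// mulr_ge0.
- by apply/measurable_EFinP; exact: measurable_rho_ratio.
- exact: (measurable_risk_tail hH0).
move=> x _; rewrite -risk_fineK; [|exact: mulr_ge0|exact: is_rule_tail].
rewrite lee_fin; apply: rho_le; first exact: mulr_ge0.
exact: tail_budget.
Qed.

Local Notation gain_rate z b := ((g z - continuation z (b - 1)) / b).

Lemma gain_rate_le z c b : 0 <= z -> 0 < c -> 1 <= b -> c <= b ->
  gain_rate z b <= (g z - rho z c) / c.
Proof.
move=> z0 c0 b1 cb; have b0 : 0 < b by lra.
rewrite ler_pdivlMr//.
have := rho_le_continuation z0 c0 b1 cb.
rewrite (_ : _ / b * c = c / b * (g z - continuation z (b - 1))); last by ring.
lra.
Qed.

(** Policies that may continue are bounded through [risk_ge_continuation]. A policy that surely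
    stops at time 0 yields no b, but its gain is 0, which is where [0 <= M] enters. *)
Lemma gain_rate_bound z c M : 0 <= z -> 0 < c -> 0 <= M ->
  (forall b, 1 <= b -> c <= b -> gain_rate z b <= M) ->
  (g z - rho z c) / c <= M.
Proof.
move=> z0 c0 M0 hM; rewrite ler_pdivrMr// lerBlDr -lerBlDl.
apply: le_rho => //; first exact: ltW.
move=> psi bpsi; have [rpsi _] := bpsi.
have Mc : 0 <= M * c by rewrite mulr_ge0// ltW.
have [psi1|psi1] := ltP (psi 0%N [tuple]) 1; last first.
  rewrite stop_at0_risk//; first lra.
  by apply/eqP; rewrite eq_le psi1 rule_le1.
have [b [b1 cb]] := risk_ge_continuation z0 c0 bpsi psi1.
have b0 : 0 < b by lra.
have := ler_wpM2r (ltW c0) (hM b b1 cb).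
rewrite (_ : _ / b * c = c / b * (g z - continuation z (b - 1))); last by ring.
lra.
Qed.

Lemma rho_lipschitz_c z c c' : 0 <= z -> 0 <= c -> c <= c' ->
  rho z c <= rho z c' + (c' - c).
Proof.
move=> z0 c0 cc'.
have rate_le1 y : 0 < y -> (g z - rho z y) / y <= 1.
  move=> y0; apply: gain_rate_bound => // b b1 yb.
  have b0 : 0 < b by lra.
  have := continuation_ge0 z0 (_ : 0 <= b - 1); have := g_le1 z.
  rewrite ler_pdivrMr//; lra.
(* At c = 0 the ratio has no meaning; there the bound is [rate_le1] at c'. *)
move: c0; rewrite le_eqVlt => /predU1P[c0|c0].
  rewrite -c0 rho_0// in cc' *; move: cc'; rewrite le_eqVlt => /predU1P[<-|c'0].
    by rewrite rho_0// subrr addr0.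
  by have := rate_le1 _ c'0; rewrite ler_pdivrMr//; lra.
have c'0 : 0 < c' by lra.
set r := (g z - rho z c) / c.
have r0 : 0 <= r.
  by apply: divr_ge0; [rewrite subr_ge0 rho_le_g//|]; exact: ltW.
(* Raising c to c' leaves fewer admissible b, so the ratio cannot increase. *)
have : (g z - rho z c') / c' <= r.
  apply: gain_rate_bound => // b b1 c'b; apply: gain_rate_le => //.
  exact: le_trans c'b.
rewrite ler_pdivrMr//.
have -> : r * c' = (g z - rho z c) + r * (c' - c).
  by rewrite mulrBr [r * c]divfK ?gt_eqF//; ring.
have : r * (c' - c) <= c' - c.
  by rewrite ler_piMl ?rate_le1// subr_ge0.
lra.
Qed.

Lemma rho_is_solution : is_solution P0 p0 p1 rho.
Proof.
split.
- move=> z c z0 c0.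
  by rewrite rho_ge0//= (le_trans (rho_le_g z0 c0))// g_le1.
- by move=> z c z0 c0; exact: integrable_rho.
- exact: rho_0.
move=> z c z0 c0; pose m := Num.max 1 c.
have m1 : 1 <= m by rewrite le_max lexx.
have mc : c <= m by rewrite le_max lexx orbT.
have [|//|||b mb bmax] := @max_ratio_attained _ (fun b => continuation z (b - 1)) (g z) m.
- by rewrite g_ge0// g_le1.
- by move=> b mb; rewrite continuation_ge0 ?continuation_le_g//; lra.
- move=> b b' mb bb'; apply/andP; split.
    rewrite -[leRHS]addr0; apply: continuation_le; rewrite ?subr_ge0//; [lra|lra|].
    by move=> y y0; rewrite addr0; apply: rho_anti => //; lra.
  have -> : b' - b = (b' - 1) - (b - 1) by ring.
  apply: continuation_le => //; [lra|lra|].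
  by move=> y y0; apply: rho_lipschitz_c => //; lra.
have rateE : (g z - rho z c) / c = gain_rate z b.
  apply/eqP; rewrite eq_le; apply/andP; split; last by apply: gain_rate_le => //; lra.
  apply: gain_rate_bound => //.
    (* The maximal rate is nonnegative because the rate at b = m already is. *)
    apply: le_trans (bmax m (lexx m)); apply: divr_ge0; last lra.
    by rewrite subr_ge0 continuation_le_g//; lra.
  by move=> b' b'1 cb'; apply: bmax; rewrite ge_max b'1.
split.
  by exists b => //; rewrite rateE unlock.
move=> _ [b' /= mb' <-]; rewrite unlock.
move: mb'; rewrite ge_max => /andP[b'1 cb'].
exact: gain_rate_le.
Qed.

End Rho.

(** * Uniqueness by comparing two solutions *)

Section Uniqueness.
Context {R : realType} {d : measure_display} {X : measurableType d}.
Variables (P0 : probability X R) (p0 p1 : X -> R).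
Hypothesis L0 : forall x, 0 <= p1 x / p0 x.

Implicit Types (f h : R -> R -> R) (z b c k : R).

(** A maximizer b for [h] is admissible in the equation of [f]. An excess of b k at budget b - 1
    becomes k after division by b, and c k after multiplication by c. *)
Lemma solution_step f h k :
  is_solution P0 p0 p1 f -> is_solution P0 p0 p1 h ->
  (forall b z, 1 <= b -> 0 <= z -> f z (b - 1) <= h z (b - 1) + b * k) ->
  forall z c, 0 <= z -> 0 < c -> f z c <= h z c + c * k.
Proof.
move=> [_ fint _ fmax] [_ hint _ hmax] fhk z c z0 c0.
have [[b /= mb hE] _] := hmax z c z0 c0; have [_ /(_ _)fub] := fmax z c z0 c0.
have := fub _ (ex_intro2 _ _ b mb erefl); move: hE; rewrite unlock.
move: mb; rewrite ge_max => /andP[b1 cb]; have b0 : 0 < b by lra.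
have bm0 : 0 <= b - 1 by lra.
have : mean P0 (fun x => f (z * (p1 x / p0 x)) (b - 1)) <=
       mean P0 (fun x => h (z * (p1 x / p0 x)) (b - 1)) + b * k.
  apply: le_mean; [exact: fint|exact: hint|].
  by move=> x; apply: fhk => //; exact: mulr_ge0.
rewrite -[fine _]/(mean P0 (fun x => h (z * (p1 x / p0 x)) (b - 1))).
rewrite -[fine (integral _ _ (fun w => (f _ _)%:E))]
  /(mean P0 (fun x => f (z * (p1 x / p0 x)) (b - 1))).
set F := mean _ _; set H := mean _ _ => FH hE.
move=> fF.
have HF : (g z - H) / b <= (g z - F) / b + k.
  by rewrite -lerBlDl -mulrBl ler_pdivrMr//; lra.
have : (g z - h z c) / c <= (g z - f z c) / c + k by rewrite -hE; lra.
by rewrite -lerBlDl -mulrBl ler_pdivrMr//; lra.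
Qed.

Lemma solution_le f h :
  is_solution P0 p0 p1 f -> is_solution P0 p0 p1 h ->
  forall z c, 0 <= z -> 0 <= c -> f z c <= h z c.
Proof.
move=> fs hs z c z0; rewrite le_eqVlt => /predU1P[<-|c0].
  by have [_ _ f0 _] := fs; have [_ _ h0 _] := hs; rewrite f0// h0.
have f01 y b : 1 <= b -> 0 <= y -> f y (b - 1) <= h y (b - 1) + 1.
  move=> b1 y0; have [f01 _ _ _] := fs; have [h01 _ _ _] := hs.
  have /andP[_ ?] : 0 <= f y (b - 1) <= 1 by apply: f01 => //; lra.
  have /andP[? _] : 0 <= h y (b - 1) <= 1 by apply: h01 => //; lra.
  lra.
have main n : forall z c, 0 <= z -> 0 < c -> f z c <= h z c + c * n.+1%:R^-1.
  elim: n => [|n ih]; apply: solution_step => // b y b1 y0.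
    by rewrite invr1 mulr1; have := f01 _ _ b1 y0; lra.
  have n2 : 0 < n.+2%:R :> R by [].
  have n1 : 0 < n.+1%:R :> R by [].
  (* For b >= n + 2 the trivial bound 1 suffices; at b = 1 the boundary condition makes the
     difference 0; in between, (b - 1) / (n + 1) <= b / (n + 2) amounts to b <= n + 2. *)
  have [bn|nb] := leP n.+2%:R b.
    apply: le_trans (f01 _ _ b1 y0) _; rewrite lerD2l.
    by rewrite ler_pdivlMr// mul1r.
  have [b10|b10] := leP b 1.
    have -> : b - 1 = 0 by lra.
    have [_ _ -> // _] := fs; have [_ _ -> // _] := hs.
    by rewrite lerDl mulr_ge0// ?invr_ge0//; lra.
  apply: le_trans (ih _ _ y0 (_ : 0 < b - 1)) _; first lra.
  rewrite lerD2l ler_pdivrMr// mulrAC ler_pdivlMr//.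
  move: nb; rewrite -[n.+2%:R]natr1; nra.
apply/ler_addgt0Pr => e e0.
(* This index n satisfies n + 1 > c / e, so that c / (n + 1) <= e. *)
apply: le_trans (main (Num.truncn (c / e)) z c z0 c0) _; rewrite lerD2l.
by rewrite ler_pdivrMr// mulrC -ler_pdivrMr// ltW// truncnS_gt.
Qed.

End Uniqueness.

Theorem lemma4p6 (R : realType)
  (d : measure_display) (X : measurableType d)
  (d' : measure_display) (Omega : measurableType d')
  (mu : {measure set X -> \bar R}) (P0 P1 : probability X R) (p0 p1 : X -> R)
  (Pr0 Pr1 : probability Omega R) (xi : nat -> Omega -> X)
  (tie : R -> rule R X -> rule R X)
  (hp0 : is_density mu P0 p0) (hp1 : is_density mu P1 p1)
  (hdom : P1 `<< P0)
  (hKL0 : KL P0 p0 p1 <> 0%E) (hKLfin : KL P0 p0 p1 \is a fin_num)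
  (hH0 : iid Pr0 P0 xi) (hH1 : iid Pr1 P1 xi)
  (htie : forall (z : R) psi, 0 <= z -> is_rule psi -> is_rule (tie z psi)) :
  is_solution P0 p0 p1 (rho Pr0 Pr1 xi p0 p1 tie) /\
  (forall f : R -> R -> R, is_solution P0 p0 p1 f ->
     forall z c : R, 0 <= z -> 0 <= c -> f z c = rho Pr0 Pr1 xi p0 p1 tie z c).
Proof.
have mL := measurable_ratio hp0 hp1; have L0 := ratio_ge0 hp0 hp1.
have densL := ratio_density hp0 hp1 hdom.
have rho_sol := rho_is_solution hH0 hH1 mL L0 densL htie.
split=> // f fsol z c z0 c0; apply/eqP; rewrite eq_le; apply/andP.
by split; [exact: (solution_le L0 fsol)|exact: (solution_le L0 rho_sol)].
Qed.
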